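(* Let $d\ge 2$ and $n\ge 1$ be integers, and let $\mathcal A$ be a symmetric Gaussian random tensor of order $d$ and dimension $n$. Then $$\mathbb E\,\rho_z(\mathcal A)\le d\sqrt n,$$ and $$\mathbb E\,\rho_h(\mathcal A)\le d\cdot 2^{\frac d2}\left(\pi^{-\frac12}\,\Gamma\left(\frac{1}{2(d-1)}+1\right)\right)^{\frac{d-1}{d}}n^{\frac{d-1}{2}}\le d\cdot 2^{\frac{d-1}{2}}\,n^{\frac{d-1}{2}},$$ where $\Gamma(\cdot)$ is the Gamma function.
   Context: A tensor $\mathcal A\in\mathbb R^{n\times\cdots\times n}$ of order $d$ is symmetric if its entries are invariant under any permutation of the indices; the set of these is denoted $\mathbb S^{n^d}$. For an index tuple $(i_1,\dots,i_d)$, let $\Pi(i_1,\dots,i_d)$ be the set of all distinct tuples obtained by permuting it, and $\mathrm{card}(\cdot)$ the cardinality of a set. A symmetric Gaussian random tensor $\mathcal A\in\mathbb S^{n^d}$ is defined as follows: the $\binom{n+d-1}{d}$ entries $\mathcal A_{i_1\cdots i_d}$ with $1\le i_1\le i_2\le\cdots\le i_d\le n$ are independent with $$\mathcal A_{i_1\cdots i_d}\sim N\left(0,\frac{d}{\mathrm{card}(\Pi(i_1,\dots,i_d))}\right)$$ (mean $0$ and the indicated variance), and every other entry is determined by symmetry, i.e. $\mathcal A_{\pi(i_1,\dots,i_d)}=\mathcal A_{i_1\cdots i_d}$ for every permutation $\pi(i_1,\dots,i_d)\in\Pi(i_1,\dots,i_d)$. For example, for $d=3$, $n=3$: $\mathcal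 A_{111}\sim N(0,3)$, $\mathcal A_{112}\sim N(0,1)$, $\mathcal A_{123}\sim N(0,\tfrac12)$. Write $\langle\mathcal A,\mathbf u\otimes\cdots\otimes\mathbf u\rangle=\sum_{i_1,\dots,i_d=1}^n\mathcal A_{i_1\cdots i_d}\mathbf u_{i_1}\cdots\mathbf u_{i_d}$ ($d$ factors of $\mathbf u$). With $\|\cdot\|$ the Euclidean norm and $\|\mathbf u\|_d=(\sum_i|\mathbf u_i|^d)^{1/d}$, the largest Z- ($\ell^2$-) eigenvalue and the largest H- ($\ell^d$-) eigenvalue of $\mathcal A\in\mathbb S^{n^d}$ are $$\rho_z(\mathcal A)=\max_{\mathbf u\in\mathbb R^n,\ \|\mathbf u\|=1}\langle\mathcal A,\mathbf u\otimes\cdots\otimes\mathbf u\rangle,\qquad \rho_h(\mathcal A)=\max_{\mathbf u\in\mathbb R^n,\ \|\mathbf u\|_d=1}\langle\mathcal A,\mathbf u\otimes\cdots\otimes\mathbf u\rangle.$$ *)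

(* Defs.v *)
From HB Require Import structures.
From mathcomp Require Import all_boot all_order all_algebra.
From mathcomp Require Import all_classical all_reals all_analysis.

Set Implicit Arguments.
Unset Strict Implicit.
Unset Printing Implicit Defensive.

Import Order.TTheory GRing.Theory Num.Theory.
Import numFieldTopology.Exports numFieldNormedType.Exports.

Local Open Scope classical_set_scope.
Local Open Scope ring_scope.

(* A real tensor of order d and dimension n, as a function of its multi-index
   (i_1, ..., i_d). *)
Definition tensor (R : realType) (n d : nat) := d.-tuple 'I_n -> R.

Definition symmetric_tensor (R : realType) (n d : nat) (A : tensor R n d) :=
  forall s t : d.-tuple 'I_n, perm_eq s t -> A s = A t.

Definition index_perms (n d : nat) (t : d.-tuple 'I_n) : {set d.-tuple 'I_n} :=
  [set s : d.-tuple 'I_n | perm_eq s t]%SET.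

Definition sorted_index (n d : nat) : {set d.-tuple 'I_n} :=
  [set t : d.-tuple 'I_n | sorted leq (map val t)]%SET.

(* <A, u (x) ... (x) u>, with d factors u. *)
Definition tensor_form (R : realType) (n d : nat) (A : tensor R n d)
    (u : 'rV[R]_n) : R :=
  \sum_(t : d.-tuple 'I_n) A t * \prod_(k < d) u 0 (tnth t k).

(* The library norm on 'rV[R]_n is the sup norm, hence these definitions. *)
Definition norm2 (R : realType) (n : nat) (u : 'rV[R]_n) : R :=
  Num.sqrt (\sum_(i < n) u 0 i ^+ 2).

Definition normd (R : realType) (n d : nat) (u : 'rV[R]_n) : R :=
  (\sum_(i < n) `|u 0 i| ^+ d) `^ (d%:R^-1).

(* The suprema below are maxima when d, n >= 1: see rho_z_max and rho_h_max. *)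
Definition rho_z (R : realType) (n d : nat) (A : tensor R n d) : R :=
  sup [set tensor_form A u | u in [set u : 'rV[R]_n | norm2 u = 1]].

Definition rho_h (R : realType) (n d : nat) (A : tensor R n d) : R :=
  sup [set tensor_form A u | u in [set u : 'rV[R]_n | normd d u = 1]].

(* Mutual independence of the subfamily (X i), i in D. *)
Definition independent_on (R : realType) (disp : measure_display)
    (T : measurableType disp) (P : probability T R) (I : finType) (D : {set I})
    (X : I -> {RV P >-> R}) : Prop :=
  forall (J : {set I}) (E : I -> set R), J \subset D ->
    (forall i, i \in J -> measurable (E i)) ->
    P (\bigcap_(i in [set` J]) (X i @^-1` E i)) =
    (\prod_(i in J) P (X i @^-1` E i))%E.

(* X ~ N(m, v); normal_prob is parameterized by the standard deviation. *)
Definition gaussian_rv (R : realType) (disp : measure_display)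
    (T : measurableType disp) (P : probability T R) (X : {RV P >-> R})
    (m v : R) : Prop :=
  forall E : set R, measurable E ->
    distribution P X E = normal_prob m (Num.sqrt v) E.

Record symmetric_gaussian_tensor (R : realType) (disp : measure_display)
    (T : measurableType disp) (P : probability T R) (n d : nat)
    (A : d.-tuple 'I_n -> {RV P >-> R}) : Prop := {
  sgt_independent : independent_on (sorted_index n d) A ;
  sgt_gaussian : forall t, t \in sorted_index n d ->
    gaussian_rv (A t) 0 (d%:R / #|index_perms t|%:R) ;
  sgt_symmetric : forall w : T, symmetric_tensor (fun t => A t w)
}.

(* Euler's Gamma function; only meaningful for x > 0. *)
Definition Gamma (R : realType) (x : R) : R :=
  \int[lebesgue_measure]_(t in `]0, +oo[) (t `^ (x - 1) * expR (- t)).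

Lemma continuous_bigop (R : realType) (T : topologicalType) (I : Type)
    (r : seq I) (op : R -> R -> R) (x0 : R) (F : I -> T -> R) :
  continuous (fun z : R * R => op z.1 z.2) ->
  (forall i, continuous (F i)) ->
  continuous (fun x => \big[op/x0]_(i <- r) F i x).
Proof.
move=> cop cF x; elim: r => [|i r IH].
  under eq_fun do rewrite big_nil; exact: cst_continuous.
under eq_fun do rewrite big_cons.
exact: (@cvg_comp _ _ _ (fun y => (F i y, \big[op/x0]_(j <- r) F j y))
  (fun z => op z.1 z.2) _ _ _ (cvg_pair (cF i x) IH) (cop (_, _))).
Qed.

Lemma tensor_form_continuous (R : realType) (n d : nat) (A : tensor R n d) :
  continuous (tensor_form A).
Proof.
apply: continuous_bigop => [|t]; first by move=> z; exact: add_continuous.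
move=> u; apply: (@cvgM _ _ (nbhs u)); first exact: cvg_cst.
apply: continuous_bigop => [|k]; first by move=> z; exact: mul_continuous.
exact: coord_continuous.
Qed.

Lemma tensor_form_max (R : realType) (n d k : nat) (A : tensor R n d) :
  (0 < k)%N -> (0 < n)%N ->
  let S := [set u : 'rV[R]_n | \sum_(i < n) `|u 0 i| ^+ k = 1] in
  exists u, [/\ S u, sup [set tensor_form A v | v in S] = tensor_form A u &
    forall v, S v -> tensor_form A v <= tensor_form A u].
Proof.
move=> k0 n0 S.
have cS : compact S.
  apply: bounded_closed_compact.
    exists 1; split=> // M M1 u uS.
    rewrite /= [leLHS]/Num.norm/= mx_normrE; apply: bigmax_le => [|[i j] _ /=].
      by rewrite (le_trans _ (ltW M1)).
    rewrite (le_trans _ (ltW M1))// -(@expr_le1 _ k)// -uS (bigD1 j)//= (ord1 i).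
    by rewrite lerDl sumr_ge0// => l _; rewrite exprn_ge0.
  have -> : S = (fun u : 'rV[R]_n => \sum_(i < n) `|u 0 i| ^+ k) @^-1` [set 1].
    by [].
  apply: preimage_closed; last exact: closed_eq.
  move=> u _; apply: continuous_bigop => [|i]; first exact: add_continuous.
  move=> v; apply: (@continuous_comp _ _ _ (fun v : 'rV[R]_n => `|v 0 i|)
    (fun x : R => x ^+ k)); last exact: exprn_continuous.
  apply: (@continuous_comp _ _ _ (fun v : 'rV[R]_n => v 0 i) Num.norm).
    exact: coord_continuous.
  exact: norm_continuous.
have S0 : S !=set0.
  exists (\row_i (i == Ordinal n0)%:R) => /=; rewrite /S/=.
  rewrite (bigD1 (Ordinal n0))//= big1 ?addr0.
    by rewrite mxE eqxx normr1 expr1n.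
  by move=> i /negPf ni; rewrite mxE ni normr0 expr0n gtn_eqF.
have [|u uS um] := @EVT_max_rV R n (tensor_form A) S S0 cS.
  by apply: continuous_subspaceT; exact: tensor_form_continuous.
rewrite inE in uS.
have {}um v : S v -> tensor_form A v <= tensor_form A u.
  by move=> Sv; apply: um; rewrite inE.
exists u; split=> //; apply/eqP; rewrite eq_le; apply/andP; split.
  apply: ge_sup; first exact: image_nonempty.
  by move=> _ [v vS <-]; exact: um.
apply: ub_le_sup; last by exists u.
by exists (tensor_form A u) => _ [v vS <-]; exact: um.
Qed.


Lemma norm2_eq1 (R : realType) (n : nat) (u : 'rV[R]_n) :
  (norm2 u = 1) = (\sum_(i < n) `|u 0 i| ^+ 2 = 1).
Proof.
rewrite /norm2; under [in RHS]eq_bigr do rewrite real_normK ?num_real//.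
have s0 : 0 <= \sum_(i < n) u 0 i ^+ 2 by apply: sumr_ge0 => i _; exact: sqr_ge0.
apply/propext; split=> [/(congr1 (fun x => x ^+ 2))|->]; last exact: sqrtr1.
by rewrite sqr_sqrtr// expr1n.
Qed.

Lemma normd_eq1 (R : realType) (n d : nat) (u : 'rV[R]_n) : (0 < d)%N ->
  (normd d u = 1) = (\sum_(i < n) `|u 0 i| ^+ d = 1).
Proof.
move=> d0; rewrite /normd.
have s0 : 0 <= \sum_(i < n) `|u 0 i| ^+ d.
  by apply: sumr_ge0 => i _; rewrite exprn_ge0.
apply/propext; split=> [|->]; last by rewrite powR1.
move/(congr1 (fun x => x `^ d%:R)).
by rewrite -powRrM mulVf ?pnatr_eq0 -?lt0n// powRr1// powR1.
Qed.

Lemma rho_z_max (R : realType) (n d : nat) (A : tensor R n d) :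
  (0 < n)%N ->
  exists u : 'rV[R]_n, [/\ norm2 u = 1, rho_z A = tensor_form A u &
    forall v, norm2 v = 1 -> tensor_form A v <= tensor_form A u].
Proof.
move=> n0; have [u [Su Eu um]] := @tensor_form_max R n d 2 A isT n0.
exists u; split=> [||v]; rewrite ?norm2_eq1 //; last exact: um.
by rewrite -Eu /rho_z; under eq_set do rewrite norm2_eq1.
Qed.

Lemma rho_h_max (R : realType) (n d : nat) (A : tensor R n d) :
  (0 < d)%N -> (0 < n)%N ->
  exists u : 'rV[R]_n, [/\ normd d u = 1, rho_h A = tensor_form A u &
    forall v, normd d v = 1 -> tensor_form A v <= tensor_form A u].
Proof.
move=> d0 n0; have [u [Su Eu um]] := tensor_form_max A d0 n0.
exists u; split=> [||v]; rewrite ?normd_eq1 //; last exact: um.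
rewrite -Eu /rho_h; under eq_set do rewrite normd_eq1//.
by [].
Qed.

(* Main.v *)
(* Both bounds are instances of the Sudakov-Fernique comparison. Put
   X_u = <A, u (x) ... (x) u> and Y_u = L <g, u>, with g standard Gaussian. The
   increments satisfy E |X_u - X_v|^2 = d |u^(x)d - v^(x)d|^2, which is at most
   L^2 |u - v|^2 with L = d on the Euclidean sphere, and with
   L^2 = d^2 2^(d-1) N^(d-1), N = n^(1 - 2/d), on the l^d sphere, where
   |u|^2 <= N (and d <= 2^(d-1)). Hence E sup X <= E sup Y = L E |g|_p, where p
   is the conjugate exponent of q = 2 or q = d; Young's inequality bounds this by
   L (n E |g_1|^p)^(1/p), and E |g_1|^p is a value of the Gamma function.

   The comparison itself avoids differentiation under the integral sign. On a
   finite net, the maximum is smoothed to log-sum-exp. The expectation of a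
   Lipschitz function of a Gaussian vector is an iterate of one-dimensional
   Gaussian averages along vectors; these commute and form semigroups, so each
   process can be run in m small steps of variance 1/m. By Taylor's formula one
   step adds to log-sum-exp 1/(2m) times the sum of the softmax variances of the
   directions, up to O(m^(-3/2)), and this sum depends on the process only
   through the variances of its increments. *)

Require Import Defs.
From HB Require Import structures.
From mathcomp Require Import all_boot all_order all_algebra.
From mathcomp Require Import all_classical all_reals all_analysis.
From mathcomp Require Import measurable_realfun ring lra.

Set Implicit Arguments.
Unset Strict Implicit.
Unset Printing Implicit Defensive.

Import Order.TTheory GRing.Theory Num.Theory.
Import numFieldTopology.Exports numFieldNormedType.Exports.

Local Open Scope classical_set_scope.
Local Open Scope ring_scope.

(** * Gaussian laws on the line *)

(** The second-order estimate of one step is available for log-sum-exp alone, not for its successive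
    averages. This is where commutation matters: a step is compared while it acts directly on
    log-sum-exp, then moved outside the remaining steps, and these, being monotone, only transport
    the error. No Gaussian measure on a vector space is built. Test functions are Lipschitz: this
    class is stable under averaging, and its members are measurable and integrable along any vector
    with integrable coordinates. Young's inequality is used with a free scale, because its bound on
    [<g, u>] is a sum of functions of single coordinates and can be averaged one coordinate at a
    time; the scale is optimised only at the end. On the [l^d] sphere the power of [n] comes from
    [N^((d-1)/2) * n^((d-1)/d) = n^((d-1)/2)]. The factor [sqrt d] left by the variance is what
    [2^((d-1)/2)] absorbs, and the Gamma expression of the moment supplies the remaining
    [sqrt 2]. *)

Section normal_law.
Context {R : realType}.
Local Notation mu := (@lebesgue_measure R).
Implicit Types (m s x y : R).

(** The Radon-Nikodym derivative of the law and [normal_pdf] have the same integral on every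
    measurable set, hence agree almost everywhere. *)
Lemma ge0_integral_normal_prob m s (f : R -> \bar R) :
  measurable_fun [set: R] f -> (forall x, 0 <= f x)%E ->
  (\int[normal_prob m s]_x f x = \int[mu]_x (f x * (normal_pdf m s x)%:E))%E.
Proof.
move=> mf f0; have dom := normal_prob_dominates m s.
rewrite -(Radon_Nikodym_SigmaFinite.change_of_variables dom)//=.
apply: ae_eq_integral => //.
- apply: emeasurable_funM => //; apply: (measurable_int mu).
  exact: Radon_Nikodym_SigmaFinite.f_integrable.
- by apply: emeasurable_funM => //; apply/measurable_EFinP; exact: measurable_normal_pdf.
- apply: ae_eqe_mul2l; apply: integral_ae_eq => //.
  + exact: Radon_Nikodym_SigmaFinite.f_integrable.
  + by apply/measurable_EFinP; exact: measurable_normal_pdf.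
  + by move=> E _ mE; rewrite -Radon_Nikodym_SigmaFinite.f_integral.
Qed.

Lemma normal_pdf_affine m s y : 0 < s ->
  normal_pdf m s (m + s * y) * s = normal_pdf 0 1 y.
Proof.
move=> s0; rewrite !normal_pdfE ?oner_eq0 ?gt_eqF// /normal_fun /normal_peak.
rewrite expr1n mul1r -mulrnAr sqrtrM ?sqr_ge0// sqrtr_sqr gtr0_norm//.
rewrite invfM mulrAC (mulrC s^-1) divfK ?gt_eqF//; congr (_ * expR _).
rewrite subr0 addrC addKr; field; rewrite ?gt_eqF//.
Qed.

Lemma ge0_integral_normal_affine m s (f : R -> R) : 0 < s ->
  continuous f -> (forall x, 0 <= f x) ->
  (\int[normal_prob m s]_x (f x)%:E =
   \int[normal_prob 0 1]_y (f (m + s * y))%:E)%E.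
Proof.
move=> s0 cf f0.
have cF : continuous (fun y : R => m + s * y).
  by move=> y; apply: cvgD; [exact: cvg_cst|apply: cvgM; [exact: cvg_cst|exact: cvg_id]].
have mf := continuous_measurable_fun cf.
have mfF : measurable_fun [set: R] (fun y => f (m + s * y)).
  by apply: continuous_measurable_fun => y; apply: continuous_comp; [exact: cF|exact: cf].
rewrite ge0_integral_normal_prob; [|exact/measurable_EFinP|by move=> x; rewrite lee_fin].
rewrite ge0_integral_normal_prob; [|exact/measurable_EFinP|by move=> x; rewrite lee_fin].
have F' : (fun y : R => m + s * y)^`()%classic = cst s.
  apply/funext => y; rewrite derive1E deriveD// derive_cst add0r.
  by rewrite deriveM// derive_cst scaler0 addr0 derive_id scaler1.
under eq_integral do rewrite -EFinM.
rewrite (@increasing_ge0_integration_by_substitutionT _ (fun y : R => m + s * y)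
  (fun x => f x * normal_pdf m s x)) //.
- apply: eq_integral => y _; rewrite F' /= -EFinM; congr EFin.
  by rewrite !fctE /= -mulrA normal_pdf_affine.
- by move=> x y xy; rewrite ltrD2l ltr_pM2l.
- by rewrite F' => x; exact: cvg_cst.
- by rewrite F'; exact: is_cvg_cst.
- by rewrite F'; exact: is_cvg_cst.
- by apply: (@cvg_comp _ _ _ ( *%R s)); [apply/gt0_cvgMrNy => //;
  exact: cvg_id|exact: cvg_addrl_Ny].
- by apply: (@cvg_comp _ _ _ ( *%R s)); [apply/gt0_cvgMry => //; exact: cvg_id|exact: cvg_addrl].
- by move=> x; apply: cvgM; [exact: cf|apply: continuous_normal_pdf; rewrite gt_eqF].
- by move=> x; rewrite mulr_ge0// normal_pdf_ge0.
Qed.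

(* The conditional density of x given z = a x + b y is again Gaussian. *)
Lemma normal_pdf_swap (a b x z : R) : b != 0 -> a ^+ 2 + b ^+ 2 = 1 ->
  normal_pdf 0 1 x * normal_pdf (a * x) b z =
  normal_pdf 0 1 z * normal_pdf (a * z) b x.
Proof.
move=> b0 ab; rewrite !normal_pdfE ?oner_eq0// /normal_fun !mulrA.
have expo u v : - (u - 0) ^+ 2 / (1 ^+ 2 *+ 2) + - (v - a * u) ^+ 2 / (b ^+ 2 *+ 2) =
    - (u ^+ 2 + v ^+ 2 - 2 * (a * u * v)) / (b ^+ 2 *+ 2).
  have -> : (v - a * u) ^+ 2 = u ^+ 2 + v ^+ 2 - 2 * (a * u * v) - b ^+ 2 * u ^+ 2.
    have -> : (v - a * u) ^+ 2 = v ^+ 2 - 2 * (a * u * v) + a ^+ 2 * u ^+ 2 by ring.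
    by rewrite -[a ^+ 2](addrK (b ^+ 2)) ab; ring.
  by rewrite subr0 expr1n; field.
rewrite ![_ * expR _ * normal_peak b]mulrAC -!mulrA -!expRD !expo.
by congr (_ * (_ * expR _)); rewrite (addrC (x ^+ 2)) [a * z * x]mulrAC.
Qed.
End normal_law.

Section standard_gaussian.
Context {R : realType}.
Local Notation mu := (@lebesgue_measure R).
Local Notation gauss := (normal_prob (0 : R) (1 : R)).
Local Notation RR := (measurableTypeR R * measurableTypeR R)%type.
Implicit Types (a b x y z : R) (f : R -> R).

Lemma measurable_normal_pdf_mean a b : b != 0 ->
  measurable_fun [set: RR] (fun xz : RR => normal_pdf (a * (xz.1 : R)) b (xz.2 : R)).
Proof.
move=> b0; under eq_fun do rewrite normal_pdfE//.
apply: measurable_funM => //; apply: measurableT_comp => //=.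
apply: measurable_funM => //; apply: measurableT_comp => //.
apply: measurable_funX; apply: measurable_funB => //.
by apply: measurable_funM.
Qed.

(** Rotation invariance. Given [x], the variable [a x + b y] has density [normal_pdf (a * x) b];
    after Tonelli, [normal_pdf_swap] leaves in [x] a density of total mass 1. Positivity of [f] is
    what Tonelli asks for. *)
Lemma ge0_integral_gauss_rot a b f : 0 < b -> a ^+ 2 + b ^+ 2 = 1 ->
  continuous f -> (forall x, 0 <= f x) ->
  (\int[gauss]_x \int[gauss]_y (f (a * x + b * y))%:E = \int[gauss]_z (f z)%:E)%E.
Proof.
move=> b0 ab cf f0; have bn0 : b != 0 by rewrite gt_eqF.
have mf := continuous_measurable_fun cf.
have mfE : measurable_fun [set: R] (fun z => (f z)%:E) by exact/measurable_EFinP.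
have fE0 z : (0 <= (f z)%:E)%E by rewrite lee_fin.
pose k (xz : RR) := (f xz.2 * normal_pdf (a * xz.1) b xz.2)%:E.
have k0 xz : (0 <= k xz)%E by rewrite lee_fin mulr_ge0// normal_pdf_ge0.
have mk : measurable_fun [set: RR] k.
  apply/measurable_EFinP; apply: measurable_funM.
    exact: (measurableT_comp mf).
  exact: measurable_normal_pdf_mean.
have innerE x : (\int[gauss]_y (f (a * x + b * y))%:E = \int[mu]_z k (x, z))%E.
  by rewrite -(@ge0_integral_normal_affine _ (a * x) b)// ge0_integral_normal_prob.
under eq_integral do rewrite innerE.
rewrite [LHS]ge0_integral_normal_prob; last 2 first.
- exact: (@measurable_fun_fubini_tonelli_F _ _ (measurableTypeR R) (measurableTypeR R) R mu k mk
  k0).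
- by move=> x; apply: integral_ge0 => z _.
pose k' (xz : RR) := (k xz * (normal_pdf 0 1 (xz.1 : R))%:E)%E.
have k'0 xz : (0 <= k' xz)%E by rewrite mule_ge0// lee_fin normal_pdf_ge0.
have mk' : measurable_fun [set: RR] k'.
  apply: emeasurable_funM => //; apply/measurable_EFinP.
  exact: (measurableT_comp (measurable_normal_pdf 0 1)).
have -> : (\int[mu]_x (\int[mu]_z k (x, z) * (normal_pdf 0 1 x)%:E) =
    \int[mu]_x \int[mu]_z k' (x, z))%E.
  apply: eq_integral => x _; rewrite -ge0_integralZr//.
  - by apply: measurableT_comp => //; exact: pair1_measurable.
  - by rewrite lee_fin normal_pdf_ge0.
rewrite (fubini_tonelli k' mk' k'0) ge0_integral_normal_prob//.
apply: eq_integral => z _.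
transitivity ((f z)%:E * (normal_pdf 0 1 z)%:E *
    \int[mu]_x (normal_pdf (a * z) b x)%:E)%E; last by rewrite integral_normal_pdf mule1.
have mpdf : measurable_fun [set: R] (fun x => (normal_pdf (a * z) b x)%:E).
  by apply/measurable_EFinP; exact: measurable_normal_pdf.
have pdf0 x : (0 <= (normal_pdf (a * z) b x)%:E)%E by rewrite lee_fin normal_pdf_ge0.
have c0 : (0 <= (f z)%:E * (normal_pdf 0 1 z)%:E)%E by rewrite mule_ge0// lee_fin normal_pdf_ge0.
rewrite -(ge0_integralZl mu measurableT mpdf (fun x _ => pdf0 x) c0).
apply: eq_integral => x _; rewrite /k' /k -!EFinM; congr EFin.
by rewrite /= -!mulrA; congr (_ * _); rewrite mulrC; exact: normal_pdf_swap.
Qed.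

(** With [u = 3/16 y^2], the quotient of the exponentials in the two densities is [exp (- 2 u)], and
    [y^4 = (16/3 u)^2 <= (16/3)^2 exp (2 u)]. A wider Gaussian thus dominates and gives a finite
    fourth moment. *)
Lemma expr4_normal_pdf_le y :
  y ^+ 4 * normal_pdf 0 1 y <=
  ((16 / 3) ^+ 2 * normal_peak 1 / normal_peak 2) * normal_pdf 0 2 y.
Proof.
rewrite !normal_pdfE ?oner_eq0 ?pnatr_eq0//.
have p2 : 0 < normal_peak (2 : R) by rewrite normal_peak_gt0// pnatr_eq0.
have p1 : 0 < normal_peak (1 : R) by rewrite normal_peak_gt0// oner_eq0.
rewrite mulrCA.
have -> : (16 / 3) ^+ 2 * normal_peak 1 / normal_peak 2 * (normal_peak 2 * normal_fun 0 2 y) =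
    normal_peak 1 * ((16 / 3) ^+ 2 * normal_fun 0 2 y) :> R.
  by rewrite mulrA divfK ?gt_eqF// [RHS]mulrCA mulrA.
rewrite ler_pM2l//.
have -> : normal_fun 0 1 y = expR (- (3 / 8 * y ^+ 2)) * normal_fun 0 2 y.
  by rewrite /normal_fun -expRD; congr expR; rewrite subr0; field.
rewrite mulrA ler_wpM2r ?expR_ge0// expRN ler_pdivrMr ?expR_gt0//.
have -> : 3 / 8 * y ^+ 2 = 3 / 16 * y ^+ 2 + 3 / 16 * y ^+ 2 by field.
rewrite expRD -expr2 -exprMn.
have -> : y ^+ 4 = (16 / 3 * (3 / 16 * y ^+ 2)) ^+ 2 by field.
have c0 : 0 <= 16 / 3 :> R by rewrite divr_ge0.
have u0 : 0 <= 3 / 16 * y ^+ 2 by rewrite mulr_ge0 ?sqr_ge0// divr_ge0.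
apply: lerXn2r; rewrite ?nnegrE.
- exact: mulr_ge0.
- by rewrite mulr_ge0// expR_ge0.
- by rewrite ler_wpM2l// (le_trans _ (expR_ge1Dx _))// lerDr.
Qed.

Lemma gauss_integrable_expr4 : gauss.-integrable setT (fun y : R => (y ^+ 4)%:E).
Proof.
have m4 : measurable_fun [set: R] (fun y : R => y ^+ 4) by exact: measurable_funX.
apply/integrableP; split; first exact/measurable_EFinP.
under eq_integral do rewrite gee0_abs ?lee_fin ?exprn_even_ge0//.
rewrite ge0_integral_normal_prob; [|exact/measurable_EFinP|]; last first.
  by move=> y; rewrite lee_fin exprn_even_ge0.
set K := ((16 / 3) ^+ 2 * normal_peak (1 : R) / normal_peak 2).
have K0 : 0 <= K by rewrite !mulr_ge0 ?invr_ge0 ?normal_peak_ge0.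
apply: (@le_lt_trans _ _ (\int[mu]_y (K%:E * (normal_pdf 0 2 y)%:E))%E).
  apply: ge0_le_integral => //.
  - by move=> y _; rewrite mule_ge0// lee_fin ?exprn_even_ge0// normal_pdf_ge0.
  - by apply: emeasurable_funM; apply/measurable_EFinP => //; exact: measurable_normal_pdf.
  - by apply: emeasurable_funM; apply/measurable_EFinP => //; exact: measurable_normal_pdf.
  - by move=> y _; rewrite -!EFinM lee_fin expr4_normal_pdf_le.
rewrite ge0_integralZl//=; last 2 first.
- by apply/measurable_EFinP; exact: measurable_normal_pdf.
- by move=> y _; rewrite lee_fin normal_pdf_ge0.
by rewrite integral_normal_pdf mule1 ltry.
Qed.

(** Growth of degree 4 covers all the integrands met below: powers up to the fourth, [|y|^p] with
    [p <= 4], and bounded exponentials. *)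
Lemma gauss_integrable K f : measurable_fun [set: R] f ->
  (forall y, `|f y| <= K * (1 + y ^+ 4)) -> gauss.-integrable setT (EFin \o f).
Proof.
move=> mf fK; apply: (@le_integrable _ _ _ gauss setT measurableT (EFin \o f)
  (fun y => (K * (1 + y ^+ 4))%:E)).
- exact/measurable_EFinP.
- move=> y _; rewrite lee_fin (le_trans (fK y))// ler_norm//.
- under eq_fun do rewrite EFinM EFinD.
  apply: integrableZl => //; apply: integrableD => //; last exact: gauss_integrable_expr4.
  apply/integrableP; split => //.
  by rewrite integral_cst//= normr1 mul1e probability_setT ltry.
Qed.
End standard_gaussian.

(** * Lipschitz functions and Gaussian averages *)

Section lipschitz_functions.
Context {R : realType} {M : nat}.
Local Notation V := ('rV[R]_M).
Implicit Types (F G : V -> R) (z a b : V).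

Lemma norm_coord_le z i : `|z 0 i| <= `|z|.
Proof.
rewrite [leRHS]/Num.norm/= mx_normrE.
exact: (le_bigmax _ (fun ij : 'I_1 * 'I_M => `|z ij.1 ij.2|) (0, i)).
Qed.

Lemma norm_le_sum_coord z : `|z| <= \sum_i `|z 0 i|.
Proof.
rewrite [leLHS]/Num.norm/= mx_normrE; apply: bigmax_le => [|[k i] _ /=].
  by apply: sumr_ge0 => i _.
by rewrite (bigD1 i)//= (ord1 k) lerDl sumr_ge0.
Qed.

(** The norm is the sup norm of row vectors, so a bound on each coordinate is a bound on the
    increment. *)
Definition lip F := exists2 C : R, 0 <= C & forall z z', `|F z - F z'| <= C * `|z - z'|.

Lemma lip_cst (c : R) : lip (fun=> c).
Proof. by exists 0 => // z z'; rewrite subrr normr0 mul0r. Qed.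

Lemma lipD F G : lip F -> lip G -> lip (fun z => F z + G z).
Proof.
move=> [C C0 FC] [D D0 GD]; exists (C + D); first exact: addr_ge0.
move=> z z'; rewrite opprD addrACA (le_trans (ler_normD _ _))// mulrDl.
exact: lerD.
Qed.

Lemma lipZ (c : R) F : lip F -> lip (fun z => c * F z).
Proof.
move=> [C C0 FC]; exists (`|c| * C); first by rewrite mulr_ge0.
by move=> z z'; rewrite -mulrBr normrM -mulrA ler_wpM2l.
Qed.

Lemma lip_sum (I : Type) (s : seq I) (F : I -> V -> R) :
  (forall i, lip (F i)) -> lip (fun z => \sum_(i <- s) F i z).
Proof.
move=> lF; elim: s => [|i s IH].
  by under eq_fun do rewrite big_nil; exact: lip_cst.
by under eq_fun do rewrite big_cons; exact: lipD.
Qed.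

(* McShane's formula [F z = sup_q (F q - C |z - q|)], [q] rational, reduces
   measurability of [F] to that of the coordinates. *)
Lemma lip_measurable d (T : measurableType d) (W : T -> V) F : lip F ->
  (forall i, measurable_fun [set: T] (fun w => W w 0 i)) ->
  measurable_fun [set: T] (fun w => F (W w)).
Proof.
move=> [C C0 FC] mW.
apply: (measurability _ (RGenOInfty.measurableE R)) => //= _ [_ [r ->] <-].
rewrite setTI.
pose q2V (q : 'rV[rat]_M) : V := map_mx ratr q.
pose g q w := F (q2V q) - C * \sum_i `|W w 0 i - q2V q 0 i|.
have mg q : measurable_fun [set: T] (g q).
  apply: measurable_funB => //; apply: measurable_funM => //.
  by apply: measurable_sum => i; apply: measurableT_comp => //; exact: measurable_funB.
have -> : (fun w => F (W w)) @^-1` `]r, +oo[ = \bigcup_q (g q @^-1` `]r, +oo[).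
  apply/seteqP; split => w /=; rewrite ?in_itv/= andbT.
    (* Replacing [W w] by a rational point within [e] costs [C * M * e] twice, in [F] and in the
       penalty. The [+ 1] keeps the denominator positive and leaves a margin [e] for the strict
       inequality. *)
    move=> rF; pose e := (F (W w) - r) / (2 * C * M%:R + 1).
    have D0 : 0 < 2 * C * M%:R + 1 by rewrite ltr_wpDl// !mulr_ge0.
    have e0 : 0 < e by rewrite divr_gt0// subr_gt0.
    have /choice[q qe] i : exists q, ratr q \in `]W w 0 i, W w 0 i + e[.
      by apply: rat_in_itvoo; rewrite ltrDl.
    have sumqe : \sum_i `|W w 0 i - q2V (\row_i q i) 0 i| <= M%:R * e.
      apply: (@le_trans _ _ (\sum_(i < M) e)); last first.
        by rewrite sumr_const card_ord mulr_natl.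
      apply: ler_sum => i _; rewrite !mxE distrC.
      have := qe i; rewrite in_itv/= => /andP[q1 q2].
      by rewrite gtr0_norm ?subr_gt0// lerBlDl ltW.
    exists (\row_i q i) => //=; rewrite in_itv/= andbT /g.
    have Cs : C * \sum_i `|W w 0 i - q2V (\row_i q i) 0 i| <= C * (M%:R * e).
      by rewrite ler_wpM2l.
    have := FC (W w) (q2V (\row_i q i)); rewrite ler_norml => /andP[_].
    have := norm_le_sum_coord (W w - q2V (\row_i q i)).
    under eq_bigr do rewrite 2!mxE.
    move=> /(ler_wpM2l C0) n1 n2.
    have : e * (2 * C * M%:R + 1) = F (W w) - r by rewrite divfK// gt_eqF.
    have -> : e * (2 * C * M%:R + 1) = 2 * (C * (M%:R * e)) + e by ring.
    lra.
  move=> [q _] /=; rewrite in_itv/= andbT /g => /lt_le_trans; apply.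
  rewrite lerBlDr -lerBlDl.
  have := FC (W w) (q2V q); rewrite ler_norml => /andP[+ _].
  have := norm_le_sum_coord (W w - q2V q).
  under eq_bigr do rewrite 2!mxE.
  move=> /(ler_wpM2l C0); lra.
apply: countable_bigcupT_measurable; first exact: countableP.
by move=> q; rewrite -[X in measurable X]setTI; exact: mg.
Qed.

End lipschitz_functions.

Lemma integral_prob_cst {R : realType} d (T : measurableType d) (m : probability T R)
  (c : \bar R) : (\int[m]_x c = c)%E.
Proof.
rewrite integral_cst//= -[RHS]mule1; congr (_ * _)%E.
exact: probability_setT.
Qed.

Lemma probT_lty {R : realType} d (T : measurableType d) (m : probability T R) :
  (m setT < +oo)%E.
Proof. by rewrite probability_setT ltry. Qed.

Lemma integrable_prob_cst {R : realType} d (T : measurableType d) (m : probability T R)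
  (r : R) : m.-integrable setT (fun=> r%:E).
Proof.
by apply/integrableP; split => //; rewrite integral_prob_cst/= ltry.
Qed.

Section lipschitz_integrals.
Context {R : realType} {M : nat}.
Local Notation V := ('rV[R]_M).

(** The dominating function is [|F 0| + C \sum_i |W w 0 i|]. Any finite measure is allowed, so that
    the lemma applies to products of two laws. *)
Lemma lip_integrable d (T : measurableType d) (mu : {measure set T -> \bar R})
    (W : T -> V) (F : V -> R) : (mu setT < +oo)%E -> lip F ->
  (forall i, mu.-integrable setT (fun w => (W w 0 i)%:E)) ->
  mu.-integrable setT (fun w => (F (W w))%:E).
Proof.
move=> muT lF iW; have [C C0 FC] := lF.
have mW i : measurable_fun setT (fun w => W w 0 i).
  exact/measurable_EFinP/(measurable_int _ (iW i)).
apply: (@le_integrable _ _ _ mu setT measurableT _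
  (fun w => (`|F 0|%:E + \sum_(i < M) (C%:E * `|(W w 0 i)%:E|))%E)).
- by apply/measurable_EFinP; exact: lip_measurable.
- move=> w _.
  have -> : (`|F 0|%:E + \sum_(i < M) (C%:E * `|(W w 0 i)%:E|) =
      (`|F 0| + C * \sum_(i < M) `|W w 0 i|)%:E)%E.
    by rewrite mulr_sumr EFinD; congr (_ + _)%E; rewrite -sumEFin.
  rewrite lee_fin [leRHS]ger0_norm; last by rewrite addr_ge0// mulr_ge0// sumr_ge0.
  have -> : F (W w) = F 0 + (F (W w) - F 0) by rewrite addrC subrK.
  rewrite (le_trans (ler_normD _ _))// lerD2l (le_trans (FC _ _))// subr0.
  by rewrite ler_wpM2l// norm_le_sum_coord.
- apply: integrableD => //.
    apply/integrableP; split => //.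
    by rewrite integral_cst//= normr_id lte_mul_pinfty.
  apply: integrable_sum => //= i _; apply: integrableZl => //.
  exact: (integrable_abse (iW i)).
Qed.

End lipschitz_integrals.

Section product_integrable.
Context {R : realType} d1 d2 (T1 : measurableType d1) (T2 : measurableType d2).
Variables (m1 : probability T1 R) (m2 : probability T2 R).

Lemma product_probT : ((m1 \x m2) setT = 1)%E.
Proof.
have <- : setT `*` setT = [set: T1 * T2] by rewrite setXTT.
rewrite product_measure1E//.
by rewrite -[RHS]mule1; congr (_ * _)%E; exact: probability_setT.
Qed.

Lemma integrable_fst (h : T1 -> \bar R) :
  m1.-integrable setT h -> (m1 \x m2)%E.-integrable setT (fun xy => h xy.1).
Proof.
move=> /integrableP[mh ih]; apply/integrable12ltyP.
  exact: (measurableT_comp mh).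
apply: le_lt_trans ih; apply: ge0_le_integral => //=.
- by move=> x _; apply: integral_ge0.
- by under eq_fun do rewrite integral_prob_cst; exact: measurableT_comp.
- exact: measurableT_comp.
- by move=> x _; rewrite integral_prob_cst.
Qed.

Lemma integrable_snd (h : T2 -> \bar R) :
  m2.-integrable setT h -> (m1 \x m2)%E.-integrable setT (fun xy => h xy.2).
Proof.
move=> /integrableP[mh ih]; apply/integrable12ltyP.
  exact: (measurableT_comp mh).
by under eq_integral do over; rewrite /= integral_prob_cst.
Qed.

End product_integrable.

Section gaussian_average.
Context {R : realType} {M : nat}.
Local Notation V := ('rV[R]_M).
Local Notation gauss := (normal_prob (0 : R) (1 : R)).
Implicit Types (F G : V -> R) (a b c z : V).

(** The heat semigroup in the direction [a]: replacing [a] by [s *: a] runs it for the time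
    [s ^+ 2]. *)
Definition gauss_avg a F z := \int[gauss]_y F (z + (y : R) *: a).

Lemma gauss_integrable_id : gauss.-integrable setT (fun y : R => y%:E).
Proof.
apply: (@gauss_integrable _ 1 id) => // y; rewrite mul1r.
have [y1|y1] := leP `|y| 1; first by rewrite (le_trans y1)// lerDl exprn_even_ge0.
rewrite (@le_trans _ _ (`|y| ^+ 4))//; first by rewrite ler_eXnr// ltW.
by rewrite -normrX ger0_norm ?exprn_even_ge0// lerDr.
Qed.

Lemma integrable_line z a i : gauss.-integrable setT (fun y : R => ((z + y *: a) 0 i)%:E).
Proof.
under eq_fun do rewrite 2!mxE EFinD mulrC EFinM.
apply: integrableD => //.
  exact: integrable_prob_cst.
by apply: integrableZl => //; exact: gauss_integrable_id.
Qed.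

Lemma lip_line_integrable F z a : lip F ->
  gauss.-integrable setT (fun y : R => (F (z + y *: a))%:E).
Proof.
move=> lF; apply: (lip_integrable _ lF); last exact: integrable_line.
exact: probT_lty.
Qed.

Lemma gauss_avgE F z a : lip F -> (gauss_avg a F z)%:E = (\int[gauss]_y (F (z + (y : R) *:
  a))%:E)%E.
Proof.
by move=> lF; rewrite /gauss_avg /Rintegral fineK//; apply: integrable_fin_num => //;
  exact: lip_line_integrable.
Qed.

Lemma gauss_Rintegral_cst (r : R) : \int[gauss]_y r = r.
Proof. by rewrite /Rintegral integral_prob_cst. Qed.

Lemma gauss_avg_cst a z (r : R) : gauss_avg a (fun=> r) z = r.
Proof. exact: gauss_Rintegral_cst. Qed.

Lemma gauss_avgD a F G z : lip F -> lip G -> gauss_avg a (fun z => F z + G z) z = gauss_avg a F z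
  + gauss_avg a G z.
Proof. by move=> lF lG; apply: RintegralD => //; exact: lip_line_integrable. Qed.

Lemma gauss_avgZ a (r : R) F z : lip F -> gauss_avg a (fun z => r * F z) z = r * gauss_avg a F z.
Proof. by move=> lF; apply: RintegralZl => //; exact: lip_line_integrable. Qed.

Lemma le_gauss_avg a F G z : lip F -> lip G -> (forall z, F z <= G z) -> gauss_avg a F z <=
  gauss_avg a G z.
Proof. by move=> lF lG FG; apply: le_Rintegral => //; exact: lip_line_integrable. Qed.

Lemma gauss_avg_lip a F : lip F -> lip (gauss_avg a F).
Proof.
move=> lF; have [C C0 FC] := lF; exists C => // z z'.
have QFB u u' : gauss_avg a F u - gauss_avg a F u' <= C * `|u - u'|.
  rewrite -RintegralB//; [|exact: lip_line_integrable..].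
  rewrite -(gauss_Rintegral_cst (C * _)); apply: le_Rintegral => //.
  - exact: (integrableB measurableT (lip_line_integrable u a lF) (lip_line_integrable u' a lF)).
  - exact: integrable_prob_cst.
  move=> y _; rewrite (le_trans (ler_norm _))// (le_trans (FC _ _))//.
  by rewrite opprD addrACA subrr addr0.
by rewrite ler_norml QFB andbT lerNl opprB distrC QFB.
Qed.

Section average_along_random_point.
Context d (S : measurableType d) (m : probability S R) (W : S -> V).
Hypothesis iW : forall i, m.-integrable setT (fun w => (W w 0 i)%:E).

Lemma lip_product_integrable F b : lip F ->
  (m \x gauss)%E.-integrable setT (fun wy => (F (W wy.1 + (wy.2 : R) *: b))%:E).
Proof.
move=> lF; apply: (@lip_integrable _ _ _ _ (m \x gauss)%E
  (fun wy => W wy.1 + (wy.2 : R) *: b)) => //.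
  by rewrite [X in (X < _)%E](product_probT m gauss) ltry.
move=> i; under eq_fun do rewrite 2!mxE EFinD mulrC EFinM.
apply: integrableD => //; first exact: (integrable_fst gauss (iW i)).
apply: integrableZl => //; apply: (@integrable_snd _ _ _ _ _ m gauss (fun y => (y : R)%:E)).
exact: gauss_integrable_id.
Qed.

End average_along_random_point.

(** Fubini for [F (z + x a + y b)], whose joint integrability follows from the Lipschitz bound. *)
Lemma gauss_avg_comm a b F z : lip F -> gauss_avg a (gauss_avg b F) z = gauss_avg b (gauss_avg a
  F) z.
Proof.
move=> lF; apply: EFin_inj.
apply: (etrans (gauss_avgE z a (gauss_avg_lip b lF)));
  apply: (etrans _ (esym (gauss_avgE z b (gauss_avg_lip a lF)))).
under eq_integral do rewrite (gauss_avgE _ _ lF).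
under [RHS]eq_integral do rewrite (gauss_avgE _ _ lF).
rewrite (Fubini (lip_product_integrable (integrable_line z a) b lF)).
apply: eq_integral => y _; apply: eq_integral => x _.
by rewrite addrAC.
Qed.

End gaussian_average.

Section gaussian_semigroup.
Context {R : realType} {M : nat}.
Local Notation V := ('rV[R]_M).
Local Notation gauss := (normal_prob (0 : R) (1 : R)).
Implicit Types (F G : V -> R) (a b c z : V).

Lemma lip_pos F : lip F -> lip (fun z => Num.max (F z) 0).
Proof.
move=> [C C0 FC]; exists C => // z z'; apply: le_trans (FC z z').
rewrite /Num.max; case: ltP => h1; case: ltP => h2.
- by rewrite subrr normr0.
- by rewrite sub0r normrN ger0_norm// distrC (le_trans _ (ler_norm _))// lerBrDr; lra.
- by rewrite subr0 ger0_norm// (le_trans _ (ler_norm _))//; lra.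
- by [].
Qed.

Lemma lip_posneg F z : F z = Num.max (F z) 0 + - 1 * Num.max (- F z) 0.
Proof. by rewrite /Num.max; case: ltP => h1; case: ltP => h2; lra. Qed.

Lemma continuous_line F z a : lip F -> continuous (fun y : R => F (z + y *: a)).
Proof.
move=> [C C0 FC] y; apply/cvgrPdist_le => e e0.
have D0 : 0 < C * `|a| + 1 by rewrite ltr_wpDl// mulr_ge0.
near=> t; rewrite (le_trans (FC _ _))//.
rewrite opprD addrACA subrr add0r -scalerBl normrZ.
have : `|y - t| <= e / (C * `|a| + 1).
  near: t; apply: (@cvgr_dist_le _ _ _ _ _ id y) => //.
  by rewrite divr_gt0.
rewrite ler_pdivlMr// => h; rewrite mulrCA (le_trans _ h)// ler_wpM2l//.
by rewrite lerDl.
Unshelve. all: by end_near. Qed.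

(** Rotation invariance is known for nonnegative continuous functions; the positive and negative
    parts of [F] are again Lipschitz and are treated separately. *)
Lemma gauss_avg_rot (al be : R) c F z : 0 < be -> al ^+ 2 + be ^+ 2 = 1 -> lip F ->
  gauss_avg (al *: c) (gauss_avg (be *: c) F) z = gauss_avg c F z.
Proof.
move=> be0 ab; wlog F0 : F / (forall z, 0 <= F z) => [ge0|] lF.
  have -> : F = (fun z => Num.max (F z) 0 + - 1 * Num.max (- F z) 0).
    by apply/funext => x; exact: lip_posneg.
  have lP := lip_pos lF.
  have lN : lip (fun z => Num.max (- F z) 0).
    by apply: lip_pos; under eq_fun do rewrite -mulN1r; exact: lipZ.
  set FP := (fun z => Num.max (F z) 0) in lP *.
  set FN := (fun z => Num.max (- F z) 0) in lN *.
  have P0 x : 0 <= FP x by rewrite /FP le_max lexx orbT.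
  have N0 x : 0 <= FN x by rewrite /FN le_max lexx orbT.
  have QE' b x : gauss_avg b (fun x => FP x + - 1 * FN x) x = gauss_avg b FP x + - 1 * gauss_avg
    b FN x.
    by rewrite gauss_avgD// ?gauss_avgZ//; exact: lipZ.
  rewrite QE' -(ge0 FP P0 lP) -(ge0 FN N0 lN).
  transitivity (gauss_avg (al *: c) (fun x => gauss_avg (be *: c) FP x + - 1 * gauss_avg (be *:
    c) FN x) z).
    by congr gauss_avg; apply/funext => x; exact: QE'.
  by rewrite gauss_avgD ?gauss_avgZ//; do ?apply: lipZ; exact: gauss_avg_lip.
apply: EFin_inj; rewrite !gauss_avgE//; last exact: gauss_avg_lip.
under eq_integral do rewrite gauss_avgE//.
have := @ge0_integral_gauss_rot _ al be (fun y => F (z + y *: c)) be0 ab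
  (@continuous_line F z c lF) (fun y => F0 _).
move=> <-; apply: eq_integral => x _; apply: eq_integral => y _.
by rewrite !scalerA scalerDl addrA [x * al]mulrC [y * be]mulrC.
Qed.

(** Variances add: rescaling [c] by [r] turns this into a rotation. The value [al = 0] is allowed;
    it occurs at the first step of an iteration. *)
Lemma gauss_avg_semigroup (al be r : R) c F z : 0 < be -> 0 < r -> al ^+ 2 + be ^+ 2 = r ^+ 2 ->
  lip F -> gauss_avg (al *: c) (gauss_avg (be *: c) F) z = gauss_avg (r *: c) F z.
Proof.
move=> be0 r0 abr lF; have rn0 : r != 0 by rewrite gt_eqF.
transitivity (gauss_avg (al / r *: (r *: c)) (gauss_avg (be / r *: (r *: c)) F) z).
  by rewrite !scalerA !divfK.
apply: gauss_avg_rot => //; first exact: divr_gt0.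
by rewrite !exprMn -mulrDl abr exprVn divff// expf_neq0.
Qed.

Lemma integral_normal_line (s : R) c F z : 0 < s -> lip F ->
  (\int[normal_prob 0 s]_y (F (z + (y : R) *: c))%:E = (gauss_avg (s *: c) F z)%:E)%E.
Proof.
move=> s0 lF; rewrite [RHS](gauss_avgE _ _ lF).
have E (G : V -> R) : lip G -> (forall x, 0 <= G x) ->
  (\int[normal_prob 0 s]_y (G (z + (y : R) *: c))%:E =
   \int[gauss]_y (G (z + (y : R) *: (s *: c)))%:E)%E.
  move=> lG G0.
  rewrite (@ge0_integral_normal_affine _ 0 s _ s0 (@continuous_line G z c lG)); last first.
    by move=> y; exact: G0.
  by apply: eq_integral => y _; rewrite add0r scalerA mulrC.
have lP := lip_pos lF.
have lN : lip (fun z => Num.max (- F z) 0).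
  by apply: lip_pos; under eq_fun do rewrite -mulN1r; exact: lipZ.
have P0 x : 0 <= Num.max (F x) 0 by rewrite le_max lexx orbT.
have N0 x : 0 <= Num.max (- F x) 0 by rewrite le_max lexx orbT.
pose fN (y : R) := (F (z + y *: c))%:E; pose fG (y : R) := (F (z + y *: (s *: c)))%:E.
have EP : (\int[normal_prob 0 s]_y fN^\+ y = \int[gauss]_y fG^\+ y)%E.
  transitivity (\int[normal_prob 0 s]_y (Num.max (F (z + (y : R) *: c)) 0)%:E)%E.
    by apply: eq_integral => y _; rewrite funeposE -EFin_max.
  by rewrite (E _ lP P0); apply: eq_integral => y _; rewrite funeposE -EFin_max.
have EN : (\int[normal_prob 0 s]_y fN^\- y = \int[gauss]_y fG^\- y)%E.
  transitivity (\int[normal_prob 0 s]_y (Num.max (- F (z + (y : R) *: c)) 0)%:E)%E.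
    by apply: eq_integral => y _; rewrite funenegE -EFin_max.
  by rewrite (E _ lN N0); apply: eq_integral => y _; rewrite funenegE -EFin_max.
transitivity (\int[gauss]_y fG^\+ y - \int[gauss]_y fG^\- y)%E.
  by rewrite -EP -EN; exact: integralE.
exact: esym (integralE _ _ _).
Qed.

End gaussian_semigroup.

(** * Mean and second moment of the standard Gaussian *)

Section gaussian_moments.
Context {R : realType}.
Local Notation gauss := (normal_prob (0 : R) (1 : R)).

(** Applied to a coordinate function, rotation invariance with the angle of the 3-4-5 triangle reads
    [(3/5 + 4/5) m = m] for the mean [m], so [m = 0]. *)
Lemma gauss_mean : \int[gauss]_y (y : R) = 0.
Proof.
pose F (z : 'rV[R]_1) := z 0 0.
have lF : lip F.
  by exists 1 => // z z'; rewrite mul1r -[_ - _](_ : (z - z') 0 0 = _) ?norm_coord_le// !mxE.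
pose c : 'rV[R]_1 := const_mx 1.
have QFE (r : R) z : gauss_avg (r *: c) F z = F z + r * \int[gauss]_y (y : R).
  rewrite /gauss_avg /F; under eq_Rintegral do rewrite !mxE mulr1 mulrC.
  rewrite RintegralD//; first by rewrite gauss_Rintegral_cst RintegralZl//;
    exact: gauss_integrable_id.
  - exact: integrable_prob_cst.
  - exact: (integrableZl measurableT r gauss_integrable_id).
have := @gauss_avg_rot _ _ (3 / 5) (4 / 5) c F 0 ltac:(lra) ltac:(field) lF.
have -> : gauss_avg (4 / 5 *: c) F = (fun z => F z + 4 / 5 * \int[gauss]_y (y : R)).
  by apply/funext => z; exact: QFE.
rewrite gauss_avgD//; last exact: lip_cst.
rewrite gauss_avg_cst QFE -[X in _ = gauss_avg X _ _]scale1r QFE; lra.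
Qed.

(** The exponential turns the density of [N(0, 1)] into [s] times that of [N(0, s^2)]. *)
Lemma gauss_expR_sqr (s : R) : 0 < s ->
  (\int[gauss]_y (expR (- ((s ^- 2 - 1) / 2 * (y : R) ^+ 2)))%:E = s%:E)%E.
Proof.
move=> s0; have mE : measurable_fun [set: R]
    (fun y : R => (expR (- ((s ^- 2 - 1) / 2 * y ^+ 2)))%:E).
  apply/measurable_EFinP; apply: measurableT_comp => //; apply: measurableT_comp => //.
  by apply: measurable_funM => //; exact: measurable_funX.
rewrite (ge0_integral_normal_prob 0 1 mE); last by move=> x; rewrite lee_fin expR_ge0.
transitivity (\int[lebesgue_measure]_x (s%:E * (normal_pdf 0 s x)%:E))%E.
  apply: eq_integral => x _; rewrite -!EFinM; congr EFin.
  have := @normal_pdf_affine R 0 s (x / s) s0.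
  rewrite add0r [s * _]mulrC divfK ?gt_eqF// mulrC => ->.
  rewrite !normal_pdfE ?oner_eq0// mulrCA /normal_fun -expRD; congr (_ * expR _).
  by rewrite !subr0; field; rewrite gt_eqF.
rewrite ge0_integralZl//=; first by rewrite integral_normal_pdf mule1.
- by apply/measurable_EFinP; exact: measurable_normal_pdf.
- by move=> x _; rewrite lee_fin normal_pdf_ge0.
- by rewrite lee_fin ltW.
Qed.

Lemma expRN_le_quad (u : R) : 0 <= u -> expR (- u) <= 1 - u + u ^+ 2.
Proof.
move=> u0; rewrite expRN (@le_trans _ _ (1 + u)^-1)//.
  by rewrite lef_pV2 ?posrE ?expR_gt0 ?expR_ge1Dx// ltr_pwDl.
rewrite -[leLHS]mul1r ler_pdivrMr ?ltr_pwDl//.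
have -> : (1 - u + u ^+ 2) * (1 + u) = 1 + u ^+ 3 by ring.
by rewrite lerDl exprn_ge0.
Qed.

Lemma gauss_integrable_sqr : gauss.-integrable setT (fun y : R => (y ^+ 2)%:E).
Proof.
apply: (@gauss_integrable _ 1 (fun y => y ^+ 2)); first exact: measurable_funX.
move=> y; rewrite mul1r ger0_norm ?sqr_ge0//.
have -> : y ^+ 4 = (y ^+ 2) ^+ 2 by rewrite -exprM.
have := sqr_ge0 (y ^+ 2 - 1); have := sqr_ge0 (y ^+ 2); lra.
Qed.

(* Compare [1 - s = E (1 - exp (- lam y^2 / 2))], [lam = s^-2 - 1], with the
   quadratic lower bound of the integrand, and let [s] tend to 1. *)
Lemma gauss_sqr_le1 : \int[gauss]_y (y : R) ^+ 2 <= 1.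
Proof.
set m2 := (X in X <= 1); pose m4 := \int[gauss]_y (y : R) ^+ 4.
have m40 : 0 <= m4 by apply: Rintegral_ge0 => y _; rewrite exprn_even_ge0.
have key (s : R) : 1 / 2 <= s -> s < 1 -> m2 <= 1 + 16 * (1 - s) * m4.
  move=> s2 s1; have s0 : 0 < s by lra.
  set l := (s ^- 2 - 1) / 2.
  have l0 : 0 <= l.
    by rewrite /l divr_ge0// subr_ge0 -exprVn expr_ge1// ?invr_ge0 ?invf_ge1// ltW.
  have : s <= 1 - l * m2 + l ^+ 2 * m4.
    have i1 : gauss.-integrable setT (fun y : R => (1 : R)%:E) by exact: integrable_prob_cst.
    have i2 : gauss.-integrable setT (fun y : R => (- l * y ^+ 2)%:E).
      exact: (integrableZl measurableT (- l) gauss_integrable_sqr).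
    have i4 : gauss.-integrable setT (fun y : R => (l ^+ 2 * y ^+ 4)%:E).
      exact: (integrableZl measurableT (l ^+ 2) gauss_integrable_expr4).
    have i12 : gauss.-integrable setT (fun y : R => (1 + - l * y ^+ 2)%:E).
      exact: (integrableD measurableT i1 i2).
    have -> : 1 - l * m2 + l ^+ 2 * m4 = \int[gauss]_y (1 + - l * (y : R) ^+ 2 + l ^+ 2 * (y : R)
      ^+ 4).
      rewrite RintegralD// RintegralD// gauss_Rintegral_cst.
      rewrite RintegralZl//; last exact: gauss_integrable_sqr.
      rewrite RintegralZl//; last exact: gauss_integrable_expr4.
      by rewrite mulNr.
    have -> : s = \int[gauss]_y (expR (- (l * (y : R) ^+ 2))) by rewrite /Rintegral gauss_expR_sqr.
    apply: le_Rintegral => //.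
    - apply: (@gauss_integrable _ 1 (fun y => expR (- (l * y ^+ 2)))).
        apply: measurableT_comp => //; apply: measurableT_comp => //.
        by apply: measurable_funM => //; exact: measurable_funX.
      move=> y; rewrite mul1r ger0_norm ?expR_ge0// (@le_trans _ _ 1)//.
        by rewrite -expR0 ler_expR oppr_le0 mulr_ge0 ?sqr_ge0.
      by rewrite lerDl exprn_even_ge0.
    - exact: (integrableD measurableT i12 i4).
    move=> y _; apply: (le_trans (expRN_le_quad _)).
      by rewrite mulr_ge0 ?sqr_ge0.
    by rewrite exprMn -exprM mulNr.
  have lE : l = (1 - s) * ((1 + s) / (2 * s ^+ 2)) by rewrite /l; field; rewrite gt_eqF.
  (* Since [1 <= k <= 4], dividing the inequality by [1 - s] gives
     [m2 <= k m2 <= 1 + (1 - s) k^2 m4], and [16] is the bound on [k^2]. *)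
  set k := (1 + s) / (2 * s ^+ 2) in lE.
  have s2p : 0 < 2 * s ^+ 2 by rewrite mulr_gt0 ?exprn_gt0.
  have ss : s ^+ 2 <= s by rewrite expr2; nra.
  have k1 : 1 <= k by rewrite /k ler_pdivlMr// mul1r; lra.
  have k4 : k <= 4.
    rewrite /k ler_pdivrMr//.
    have : 1 / 4 <= s ^+ 2 by rewrite expr2; nra.
    lra.
  rewrite lE => h.
  have : (1 - s) * (1 - k * m2 + (1 - s) * k ^+ 2 * m4) >= 0.
    have -> : (1 - s) * (1 - k * m2 + (1 - s) * k ^+ 2 * m4) =
      1 - (1 - s) * k * m2 + ((1 - s) * k) ^+ 2 * m4 - s by ring.
    by rewrite subr_ge0.
  rewrite pmulr_rge0 ?subr_gt0// => h2.
  have m20 : 0 <= m2 by apply: Rintegral_ge0 => y _; rewrite sqr_ge0.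
  have k2 : k ^+ 2 <= 16 by rewrite (_ : 16 = 4 ^+ 2); [rewrite lerXn2r ?nnegrE//; lra|ring].
  have : (1 - s) * k ^+ 2 * m4 <= 16 * (1 - s) * m4.
    by rewrite ler_wpM2r// mulrC ler_wpM2r//; lra.
  have : m2 <= k * m2 by rewrite ler_peMl.
  lra.
apply/ler_addgt0Pr => e e0.
(* Chosen so that [16 (1 - s) m4 <= e]; the [m4 + 1] keeps the denominator positive. *)
pose s := Num.max (1 / 2) (1 - e / (16 * (m4 + 1))).
have D0 : 0 < 16 * (m4 + 1) by lra.
have s2 : 1 / 2 <= s by rewrite le_max lexx.
have s1 : s < 1 by rewrite gt_max; apply/andP; split; [lra|rewrite ltrBlDr ltrDl divr_gt0].
apply: (le_trans (key s s2 s1)); rewrite lerD2l.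
have : 1 - s <= e / (16 * (m4 + 1)) by rewrite lerBlDr -lerBlDl le_max lexx orbT.
rewrite ler_pdivlMr// => h; apply: le_trans h.
have -> : (1 - s) * (16 * (m4 + 1)) = 16 * (1 - s) * m4 + 16 * (1 - s) by ring.
lra.
Qed.

End gaussian_moments.

(** * Log-sum-exp *)

Section mean_value.
Context {R : realType}.
Implicit Types (f df : R -> R) (s : R).

Lemma MVT0 f df s : (forall x : R, is_derive x 1 f (df x)) ->
  exists2 c, `|c| <= `|s| & f s - f 0 = df c * s.
Proof.
move=> fd; have cf (a b : R) : {within `[a, b], continuous f}.
  apply: continuous_subspaceT => x.
  by apply: differentiable_continuous; apply/derivable1_diffP; case: (fd x).
have [s0|s0] := leP 0 s.
  have [c + e] := @MVT_segment _ f df 0 s s0 (fun x _ => fd x) (cf 0 s).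
  rewrite in_itv/= => /andP[c0 cs]; exists c; first by rewrite !ger0_norm.
  by rewrite e subr0.
have [c + e] := @MVT_segment _ f df s 0 (ltW s0) (fun x _ => fd x) (cf s 0).
rewrite in_itv/= => /andP[c0 cs]; exists c; first by rewrite !ler0_norm ?lerN2// ltW.
by rewrite -opprB e sub0r mulrN opprK.
Qed.

(** Mean value theorem twice: for the remainder [h] of [f'], then for [g], whose derivative is [h].
    Lipschitz control of [f''] at 0 stands in for a third derivative. *)
Lemma taylor1_bound f f' f'' (K : R) s : 0 <= K ->
  (forall x : R, is_derive x 1 f (f' x)) -> (forall x : R, is_derive x 1 f' (f'' x)) ->
  (forall x, `|f'' x - f'' 0| <= K * `|x|) ->
  `|f s - f 0 - s * f' 0 - s ^+ 2 / 2 * f'' 0| <= K * `|s| ^+ 3.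
Proof.
move=> K0 df df' fK.
pose g x := f x - f 0 - x * f' 0 - x ^+ 2 / 2 * f'' 0.
pose h x := f' x - f' 0 - x * f'' 0.
have dh (x : R) : is_derive x 1 h (f'' x - f'' 0).
  rewrite /h; apply: is_derive_eq; rewrite scaler0 add0r subr0 [_ *: 1]mulr1; ring.
have dg (x : R) : is_derive x 1 g (h x).
  rewrite /g; apply: is_derive_eq.
  by rewrite !scaler0 !add0r /h !subr0 /GRing.scale/= !mulr1; field.
have g0 : g 0 = 0 by rewrite /g subrr expr0n/= !mul0r !subr0.
have h0 : h 0 = 0 by rewrite /h subrr mul0r subr0.
have hK x : `|h x| <= K * `|x| ^+ 2.
  have [c cx] := @MVT0 h _ x dh; rewrite h0 subr0 => ->.
  rewrite normrM expr2 mulrA ler_wpM2r// (le_trans (fK c))//.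
  by rewrite ler_wpM2l.
have [c cx] := @MVT0 g _ s dg; rewrite g0 subr0 /g => ->.
rewrite normrM exprSr mulrA ler_wpM2r// (le_trans (hK c))//.
by rewrite ler_wpM2l// lerXn2r.
Qed.

End mean_value.

Section log_sum_exp.
Context {R : realType} {M : nat}.
Hypothesis M0 : (0 < M)%N.
Local Notation V := ('rV[R]_M).
Implicit Types (c e : 'I_M -> R) (z a b : V) (s B : R).

Definition sumexp c z := \sum_i expR (z 0 i) * c i.
Definition lse z := ln (sumexp (fun=> 1) z).
Definition softavg c z := sumexp c z / sumexp (fun=> 1) z.
(** The variance of the coordinates of [a] under the softmax weights of [z]; it is the second
    derivative of [lse] at [z] along [a]. *)
Definition softvar a z :=
  softavg (fun i => a 0 i ^+ 2) z - softavg (fun i => a 0 i) z ^+ 2.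

Lemma sumexp1_gt0 z : 0 < sumexp (fun=> 1) z.
Proof.
rewrite /sumexp (bigD1 (Ordinal M0))//= ltr_wpDr//.
  by apply: sumr_ge0 => i _; rewrite mulr1 expR_ge0.
by rewrite mulr1 expR_gt0.
Qed.

Lemma softavg_le c z B : (forall i, `|c i| <= B) -> `|softavg c z| <= B.
Proof.
move=> cB; rewrite normrM normfV (gtr0_norm (sumexp1_gt0 z)).
rewrite ler_pdivrMr ?sumexp1_gt0// (le_trans (ler_norm_sum _ _ _))//.
rewrite /sumexp mulr_sumr; apply: ler_sum => i _.
by rewrite normrM mulr1 (ger0_norm (expR_ge0 _)) mulrC ler_wpM2r// expR_ge0.
Qed.

Lemma is_derive_sumexp c z b s :
  is_derive s 1 (fun s => sumexp c (z + s *: b)) (sumexp (fun i => c i * b 0 i) (z + s *: b)).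
Proof.
rewrite (_ : (fun s => _) = \sum_(i < M) (fun s => c i * expR (z 0 i + b 0 i * s))); last first.
  apply/funext => x; rewrite fct_sumE; apply: eq_bigr => i _.
  by rewrite !mxE mulrC [x * _]mulrC.
rewrite (_ : sumexp _ _ = \sum_(i < M) (c i * (expR (z 0 i + b 0 i * s) * b 0 i))); last first.
  by apply: eq_bigr => i _; rewrite !mxE [s * _]mulrC mulrCA.
apply: is_derive_sum => i.
have : is_derive s 1 (expR \o (fun s => z 0 i + b 0 i * s)) (expR (z 0 i + b 0 i * s) * b 0 i).
  apply: is_derive1_comp; apply: is_derive_eq.
  by rewrite add0r mul1r [_ *: 1]mulr1.
move=> h; apply: is_derive_eq.
by [].
Qed.

(** The quotient rule produces the softmax covariance of [c] and [b]; for [c = b] it is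
    [softvar]. *)
Lemma is_derive_softavg c z b s :
  is_derive s 1 (fun s => softavg c (z + s *: b))
    (softavg (fun i => c i * b 0 i) (z + s *: b) -
     softavg c (z + s *: b) * softavg (fun i => b 0 i) (z + s *: b)).
Proof.
have n0 : sumexp (fun=> 1) (z + s *: b) != 0 by rewrite gt_eqF// sumexp1_gt0.
have dV := @is_deriveV _ (fun s => sumexp (fun=> 1) (z + s *: b)) _ _ _ n0
  (is_derive_sumexp (fun=> 1) z b s).
have := is_deriveM (is_derive_sumexp c z b s) dV.
move=> h; apply: is_derive_eq.
rewrite /softavg /GRing.scale/=.
have -> : sumexp (fun i => 1 * b 0 i) = sumexp (fun i => b 0 i).
  by congr sumexp; apply/funext => i; rewrite mul1r.
by field.
Qed.

Lemma is_derive_lse z b s :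
  is_derive s 1 (fun s => lse (z + s *: b)) (softavg (fun i => b 0 i) (z + s *: b)).
Proof.
have n0 := sumexp1_gt0 (z + s *: b).
have := @is_derive1_comp _ (@ln R) _ _ _ _ (is_derive1_ln n0) (is_derive_sumexp (fun=> 1) z b s).
move=> h; apply: is_derive_eq; rewrite mulrC /softavg; congr (_ / _).
by congr sumexp; apply/funext => i; rewrite mul1r.
Qed.

Lemma lip_lse : lip lse.
Proof.
exists 1 => // z z'; have [c _] := @MVT0 _ _ _ 1 (is_derive_lse z' (z - z')).
rewrite scale1r scale0r addr0 subrKC mulr1 => ->; rewrite mul1r.
by apply: softavg_le => i; exact: norm_coord_le.
Qed.

Lemma softavg_lip_bound c B z z' : (forall i, `|c i| <= B) ->
  `|softavg c z - softavg c z'| <= 2 * B * `|z - z'|.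
Proof.
move=> cB; have [x _] := @MVT0 _ _ _ 1 (is_derive_softavg c z' (z - z')).
rewrite scale1r scale0r addr0 subrKC mulr1 => ->.
set b := z - z'; set w := z' + _.
have bi i : `|b 0 i| <= `|b| by exact: norm_coord_le.
rewrite (le_trans (ler_normB _ _))// -mulrA mulr_natl mulr2n lerD//.
  apply: softavg_le => i; rewrite normrM.
  by rewrite ler_pM.
by rewrite normrM ler_pM// softavg_le.
Qed.

(** The [6] is [2 + 2 * 2]: [2] from the mean of the squares, and [2 * 2] from the square of the
    mean, factored as [(x - y) (x + y)]. *)
Lemma softvar_lip_bound a z z' :
  `|softvar a z - softvar a z'| <= 6 * `|a| ^+ 2 * `|z - z'|.
Proof.
have a1 i : `|a 0 i| <= `|a| by exact: norm_coord_le.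
have a2 i : `|a 0 i ^+ 2| <= `|a| ^+ 2 by rewrite normrX lerXn2r ?nnegrE.
have h1 := softavg_lip_bound z z' a1.
have h2 := softavg_lip_bound z z' a2.
have b1 := softavg_le z a1.
have b2 := softavg_le z' a1.
rewrite /softvar; set x := softavg _ z in h1 b1 *; set y := softavg _ z' in h1 b2 *.
set u := softavg _ z in h2 *; set v := softavg _ z' in h2 *.
have -> : u - x ^+ 2 - (v - y ^+ 2) = (u - v) - (x - y) * (x + y) by ring.
rewrite (le_trans (ler_normB _ _))//.
have -> : 6 * `|a| ^+ 2 * `|z - z'| =
  2 * `|a| ^+ 2 * `|z - z'| + (2 * `|a| * `|z - z'|) * (2 * `|a|) by ring.
apply: lerD => //; rewrite normrM ler_pM//.
by rewrite (le_trans (ler_normD _ _))//; lra.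
Qed.

Lemma lip_softvar a : lip (softvar a).
Proof.
exists (6 * `|a| ^+ 2); first by rewrite mulr_ge0// exprn_ge0.
exact: softvar_lip_bound.
Qed.

Lemma lse_taylor z a s :
  `|lse (z + s *: a) - lse z - s * softavg (fun i => a 0 i) z - s ^+ 2 / 2 * softvar a z|
  <= 6 * `|a| ^+ 3 * `|s| ^+ 3.
Proof.
have := @taylor1_bound _ _ _ (fun s => softvar a (z + s *: a)) (6 * `|a| ^+ 3) s _
  (is_derive_lse z a).
rewrite scale0r addr0; apply.
- by rewrite mulr_ge0// exprn_ge0.
- by move=> x; apply: is_derive_softavg.
- move=> x; rewrite (le_trans (softvar_lip_bound _ _ _))//.
  by rewrite addrAC subrr add0r normrZ exprSr !mulrA mulrAC.
Qed.

(** A variance is half the mean squared difference of two independent draws. This form shows that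
    only the increments [a 0 i - a 0 j] matter, with nonnegative weights that do not depend on
    [a]. *)
Lemma softvarE a z : softvar a z =
  (\sum_i \sum_j expR (z 0 i) * expR (z 0 j) * (a 0 i - a 0 j) ^+ 2) /
  (2 * sumexp (fun=> 1) z ^+ 2).
Proof.
have n0 : sumexp (fun=> 1) z != 0 by rewrite gt_eqF// sumexp1_gt0.
have -> : \sum_i \sum_j expR (z 0 i) * expR (z 0 j) * (a 0 i - a 0 j) ^+ 2 =
  2 * (sumexp (fun=> 1) z * sumexp (fun i => a 0 i ^+ 2) z - sumexp (fun i => a 0 i) z ^+ 2).
  pose w i := expR (z 0 i).
  have e1 : sumexp (fun=> 1) z * sumexp (fun i => a 0 i ^+ 2) z =
      \sum_i \sum_j w i * w j * a 0 j ^+ 2.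
    rewrite /sumexp mulr_suml; apply: eq_bigr => i _; rewrite mulr_sumr.
    by apply: eq_bigr => j _; rewrite /w; ring.
  have e2 : sumexp (fun i => a 0 i) z ^+ 2 = \sum_i \sum_j w i * w j * (a 0 i * a 0 j).
    rewrite expr2 /sumexp mulr_suml; apply: eq_bigr => i _; rewrite mulr_sumr.
    by apply: eq_bigr => j _; rewrite /w; ring.
  have e3 : \sum_i \sum_j w i * w j * a 0 i ^+ 2 = \sum_i \sum_j w i * w j * a 0 j ^+ 2.
    by rewrite exchange_big/=; apply: eq_bigr => i _; apply: eq_bigr => j _; rewrite (mulrC (w j)).
  transitivity (\sum_i \sum_j w i * w j * a 0 i ^+ 2 + \sum_i \sum_j w i * w j * a 0 j ^+ 2 -
      (\sum_i \sum_j w i * w j * (a 0 i * a 0 j) + \sum_i \sum_j w i * w j * (a 0 i * a 0 j))).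
    rewrite -!big_split -sumrB/=; apply: eq_bigr => i _.
    by rewrite -!big_split -sumrB/=; apply: eq_bigr => j _; rewrite /w; ring.
  by rewrite e3 e1 e2; ring.
by rewrite /softvar /softavg; field.
Qed.

End log_sum_exp.

(** * Comparison of Gaussian averages *)

Section iterated_average.
Context {R : realType} {M : nat}.
Local Notation V := ('rV[R]_M).
Implicit Types (F G : V -> R) (z b : V).

(** This is [E F (z + \sum_(j <- s) g_j a_j)] for independent standard Gaussian [g_j], written as an
    iterate. The head is averaged innermost, but the order is immaterial by [gauss_avg_comm]. *)
Fixpoint gauss_avgs {J : Type} (a : J -> V) (s : seq J) F : V -> R :=
  if s is j :: s' then gauss_avgs a s' (gauss_avg (a j) F) else F.

Lemma gauss_avg0 F z : gauss_avg 0 F z = F z.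
Proof.
rewrite /gauss_avg; under eq_Rintegral do rewrite scaler0 addr0.
exact: gauss_Rintegral_cst.
Qed.

Lemma gauss_avg_addc b F z (c : R) : lip F -> gauss_avg b (fun z => F z + c) z = gauss_avg b F z
  + c.
Proof. by move=> lF; rewrite gauss_avgD// ?gauss_avg_cst//; exact: lip_cst. Qed.

Lemma gauss_avg_sum b (I : Type) (s : seq I) (F : I -> V -> R) z : (forall i, lip (F i)) ->
  gauss_avg b (fun z => \sum_(i <- s) F i z) z = \sum_(i <- s) gauss_avg b (F i) z.
Proof.
move=> lF; elim: s => [|i s IH].
  rewrite big_nil (_ : (fun z => _) = fun=> 0) ?gauss_avg_cst//.
  by apply/funext => x; rewrite big_nil.
rewrite big_cons -IH -gauss_avgD//; last exact: lip_sum.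
rewrite (_ : (fun z => _) = fun x => F i x + \sum_(j <- s) F j x)//.
by apply/funext => x; rewrite big_cons.
Qed.

Lemma gauss_avg_dist b F G (e : R) z : lip F -> lip G -> (forall z, `|F z - G z| <= e) ->
  `|gauss_avg b F z - gauss_avg b G z| <= e.
Proof.
move=> lF lG FG; rewrite ler_distl; apply/andP; split.
  rewrite lerBlDr -gauss_avg_addc//; apply: le_gauss_avg => //.
    by apply: lipD => //; exact: lip_cst.
  by move=> x; have := FG x; rewrite ler_distl lerBlDr => /andP[].
rewrite -gauss_avg_addc//; apply: le_gauss_avg => //.
  by apply: lipD => //; exact: lip_cst.
by move=> x; have := FG x; rewrite ler_distl => /andP[].
Qed.

Section one_family.
Context {J : Type}.
Implicit Types (a : J -> V) (s : seq J).

Lemma lip_gauss_avgs a s F : lip F -> lip (gauss_avgs a s F).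
Proof. by elim: s F => //= j s IH F lF; apply: IH; exact: gauss_avg_lip. Qed.

Lemma le_gauss_avgs a s F G : lip F -> lip G -> (forall z, F z <= G z) ->
  forall z, gauss_avgs a s F z <= gauss_avgs a s G z.
Proof.
elim: s F G => //= j s IH F G lF lG FG; apply: IH; [exact: gauss_avg_lip|exact: gauss_avg_lip|].
by move=> z; exact: le_gauss_avg.
Qed.

Lemma gauss_avgs_addc a s F (c : R) : lip F ->
  gauss_avgs a s (fun z => F z + c) = (fun z => gauss_avgs a s F z + c).
Proof.
elim: s F => //= j s IH F lF; rewrite -IH; last exact: gauss_avg_lip.
have -> // : gauss_avg (a j) (fun z => F z + c) = (fun z => gauss_avg (a j) F z + c).
by apply/funext => z; exact: gauss_avg_addc.
Qed.

Lemma gauss_avg_avgs b a s F : lip F -> gauss_avg b (gauss_avgs a s F) = gauss_avgs a s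
  (gauss_avg b F).
Proof.
elim: s F => //= j s IH F lF; rewrite IH; last exact: gauss_avg_lip.
have -> // : gauss_avg b (gauss_avg (a j) F) = gauss_avg (a j) (gauss_avg b F).
by apply/funext => z; exact: gauss_avg_comm.
Qed.

Lemma gauss_avgs_cons a j s F : lip F -> gauss_avgs a (j :: s) F = gauss_avg (a j) (gauss_avgs a
  s F).
Proof. by move=> lF /=; rewrite gauss_avg_avgs. Qed.

(** In each direction the variance [k e^2] is a sum of [k] variances [e^2]; commutation regroups the
    pieces of all directions into [k] identical rounds. *)
Lemma gauss_avgs_iter a s (e : R) k F : 0 < e -> lip F ->
  gauss_avgs (fun j => (Num.sqrt k%:R * e) *: a j) s F = iter k (gauss_avgs (fun j => e *: a j)
    s) F.
Proof.
move=> e0; elim: k F => [|k IH] F lF.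
  rewrite sqrtr0 mul0r /=; elim: s F lF => //= j s IHs F lF.
  have -> : gauss_avg (0 *: a j) F = F by apply/funext => z; rewrite scale0r gauss_avg0.
  exact: IHs.
rewrite iterSr -IH; last exact: lip_gauss_avgs.
elim: s F lF {IH} => //= j s IHs F lF.
have -> : gauss_avg ((Num.sqrt k.+1%:R * e) *: a j) F =
  gauss_avg ((Num.sqrt k%:R * e) *: a j) (gauss_avg (e *: a j) F).
  apply/funext => z; rewrite (@gauss_avg_semigroup _ _ _ _ (Num.sqrt k.+1%:R * e))//.
    by rewrite mulr_gt0// sqrtr_gt0 ltr0n.
  rewrite !exprMn !sqr_sqrtr ?ler0n//.
  by rewrite -natr1 mulrDl mul1r.
have l1 : lip (gauss_avg (e *: a j) F) by exact: gauss_avg_lip.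
by rewrite IHs ?gauss_avg_avgs//; exact: gauss_avg_lip.
Qed.

End one_family.

Lemma gauss_avgs_avgs {J J' : Type} (a : J -> V) (b : J' -> V) s t F : lip F ->
  gauss_avgs a s (gauss_avgs b t F) = gauss_avgs b t (gauss_avgs a s F).
Proof.
elim: s F => //= j s IH F lF; rewrite -IH; last exact: gauss_avg_lip.
by rewrite gauss_avg_avgs.
Qed.

(* [N] steps of size [N^(-1/2)], each with an error [O(N^(-3/2))]. *)
Lemma gauss_avgs_compare {J J' : Type} (a : J -> V) (b : J' -> V) s t F (K : R) z :
  lip F -> 0 <= K ->
  (forall e : R, 0 < e <= 1 -> forall z,
    gauss_avgs (fun j => e *: a j) s F z <= gauss_avgs (fun j => e *: b j) t F z + K * e ^+ 3) ->
  gauss_avgs a s F z <= gauss_avgs b t F z.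
Proof.
move=> lF K0 step.
have lipA (e : R) k : lip (iter k (gauss_avgs (fun j => e *: a j) s) F).
  by elim: k => //= k IH; exact: lip_gauss_avgs.
have lipB (e : R) k : lip (iter k (gauss_avgs (fun j => e *: b j) t) F).
  by elim: k => //= k IH; exact: lip_gauss_avgs.
have key (e : R) k : 0 < e <= 1 -> forall z,
    iter k (gauss_avgs (fun j => e *: a j) s) F z <=
    iter k (gauss_avgs (fun j => e *: b j) t) F z + k%:R * (K * e ^+ 3).
  move=> e01; elim: k => [|k IH] x; first by rewrite mul0r addr0.
  set A := gauss_avgs (fun j => e *: a j) s in IH *;
    set B := gauss_avgs (fun j => e *: b j) t in IH *.
  (* The hypothesis compares [A] and [B] on [F] only. So [A^(k+1) F = A^k (A F)] is first compared
     with [A^k (B F)], and commuting [B] outside leaves [B (A^k F)], to which the induction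
     hypothesis applies under the monotone [B]. *)
  have comm : iter k A (B F) = B (iter k A F).
    elim: k {IH} => //= k ->; rewrite /A /B gauss_avgs_avgs//; exact: lipA.
  have iterA_le G H (c : R) : lip G -> lip H -> (forall z, G z <= H z + c) ->
      forall z, iter k A G z <= iter k A H z + c.
    move=> lG lH GH; elim: (k) => //= l IHl y.
    have lipiter G' : lip G' -> lip (iter l A G').
      by move=> lG'; elim: (l) => //= l' IH'; exact: lip_gauss_avgs.
    have := @le_gauss_avgs _ (fun j => e *: a j) s _ _ (lipiter _ lG)
      (lipD (lipiter _ lH) (lip_cst c)) IHl y.
    by rewrite gauss_avgs_addc//; exact: lipiter.
  rewrite iterSr (le_trans (iterA_le _ _ _ _ _ (step e e01) x))//; do ?exact: lip_gauss_avgs.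
  rewrite -/B comm -[k.+1%:R]natr1 mulrDl mul1r addrA lerD2r /=.
  have := @le_gauss_avgs _ (fun j => e *: b j) t _ _ (lipA e k)
      (lipD (lipB e k) (lip_cst (k%:R * (K * e ^+ 3)))) IH x.
  by rewrite gauss_avgs_addc//; exact: lipB.
apply/ler_addgt0Pr => ep ep0.
(* With [e = N^(-1/2)] the accumulated error is [N K e^3 = K / sqrt N], at most [ep] as soon as
   [N > (K / ep)^2]. *)
pose N := (Num.truncn ((K / ep) ^+ 2)).+1.
have N0 : 0 < N%:R :> R by rewrite ltr0n.
have sN0 : 0 < Num.sqrt N%:R :> R by rewrite sqrtr_gt0.
have KN : (K / ep) ^+ 2 < N%:R by rewrite truncnS_gt.
pose e : R := (Num.sqrt N%:R)^-1.
have e0 : 0 < e by rewrite invr_gt0.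
have e1 : e <= 1 by rewrite invf_le1// -[leLHS]sqrtr1 ler_wsqrtr// ler1n.
have := key e N _ z; rewrite e0 e1 => /(_ isT).
rewrite -!gauss_avgs_iter// /e mulfV ?gt_eqF//.
have scale1 (I : Type) (c : I -> V) : (fun j => 1 *: c j) = c.
  by apply/funext => j; rewrite scale1r.
rewrite !scale1 => h; apply: (le_trans h); rewrite lerD2l.
have -> : N%:R * (K * (Num.sqrt N%:R)^-1 ^+ 3) = K / Num.sqrt N%:R.
  rewrite -[X in X * (K * _)](@sqr_sqrtr _ N%:R) ?ler0n//.
  by field; rewrite gt_eqF.
rewrite ler_pdivrMr// mulrC -ler_pdivrMr//.
rewrite -(ler_pXn2r (n := 2))// ?nnegrE ?sqrtr_ge0//; last by rewrite divr_ge0// ltW.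
by rewrite sqr_sqrtr ltW.
Qed.

End iterated_average.

Section lse_comparison.
Context {R : realType} {M : nat}.
Hypothesis M0 : (0 < M)%N.
Local Notation V := ('rV[R]_M).
Local Notation gauss := (normal_prob (0 : R) (1 : R)).
Implicit Types (F G : V -> R) (z a b : V) (e : R).

Lemma gauss_integrable_normX k : (k <= 4)%N ->
  gauss.-integrable setT (fun y : R => (`|y| ^+ k)%:E).
Proof.
move=> k4; apply: (@gauss_integrable _ 1 (fun y => `|y| ^+ k)).
  by apply: measurable_funX; exact: normr_measurable.
move=> y; rewrite mul1r ger0_norm ?exprn_ge0//.
have [y1|y1] := leP `|y| 1; first by rewrite (@le_trans _ _ 1) ?exprn_ile1 ?lerDl ?exprn_even_ge0.
rewrite (@le_trans _ _ (`|y| ^+ 4)) ?ler_weXn2l ?(ltW y1)//.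
by rewrite -normrX ger0_norm ?exprn_even_ge0// lerDr.
Qed.

Lemma gauss_avg_lip_dist F (C : R) b z : 0 <= C -> (forall z z', `|F z - F z'| <= C * `|z - z'|) ->
  `|gauss_avg b F z - F z| <= C * `|b| * \int[gauss]_y `|y : R|.
Proof.
move=> C0 FC; have lF : lip F by exists C.
have i1 := gauss_integrable_normX (isT : (1 <= 4)%N).
have iF := lip_line_integrable z b lF; have ic := integrable_prob_cst gauss (F z).
rewrite -(gauss_Rintegral_cst (F z)) -RintegralB//.
have iB := integrableB measurableT iF ic.
apply: (le_trans (le_normr_Rintegral measurableT iB)).
rewrite -RintegralZl//; apply: le_Rintegral => //.
- exact: (integrable_abse iB).
- exact: (integrableZl measurableT (C * `|b|) i1).
move=> y _; rewrite (le_trans (FC _ _))// -mulrA ler_wpM2l//.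
by rewrite addrAC subrr add0r normrZ mulrC.
Qed.

(** Taylor's formula is integrated in [y]: the linear term vanishes by [gauss_mean], and the
    remainder is controlled by the third absolute moment. *)
Lemma gauss_avg_lse_step a e z : 0 <= e ->
  `|gauss_avg (e *: a) lse z - (lse z + e ^+ 2 / 2 * (\int[gauss]_y (y : R) ^+ 2) * softvar a z)| <=
  6 * `|a| ^+ 3 * (\int[gauss]_y `|y : R| ^+ 3) * e ^+ 3.
Proof.
move=> e0; set A := softavg (fun i => a 0 i) z; set S := softvar a z.
have i1 := @gauss_integrable_id R; have i2 := @gauss_integrable_sqr R.
have i3 := gauss_integrable_normX (isT : (3 <= 4)%N).
have iF := lip_line_integrable z (e *: a) (lip_lse M0).
have ic := integrable_prob_cst gauss (lse z).
have j1 : gauss.-integrable setT (fun y : R => (e * A * y)%:E).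
  exact: (integrableZl measurableT (e * A) i1).
have j2 : gauss.-integrable setT (fun y : R => (e ^+ 2 / 2 * S * y ^+ 2)%:E).
  exact: (integrableZl measurableT (e ^+ 2 / 2 * S) i2).
have ic1 : gauss.-integrable setT (fun y : R => (lse z + e * A * y)%:E).
  exact: (integrableD measurableT ic j1).
have ip : gauss.-integrable setT (fun y : R => (lse z + e * A * y + e ^+ 2 / 2 * S * y ^+ 2)%:E).
  exact: (integrableD measurableT ic1 j2).
have -> : lse z + e ^+ 2 / 2 * (\int[gauss]_y (y : R) ^+ 2) * S =
    \int[gauss]_y (lse z + e * A * (y : R) + e ^+ 2 / 2 * S * (y : R) ^+ 2).
  rewrite RintegralD// RintegralD// gauss_Rintegral_cst RintegralZl// RintegralZl//.
  by rewrite gauss_mean mulr0 addr0 mulrAC.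
rewrite -RintegralB//.
have iB := integrableB measurableT iF ip.
apply: (le_trans (le_normr_Rintegral measurableT iB)).
have -> : 6 * `|a| ^+ 3 * (\int[gauss]_y `|y : R| ^+ 3) * e ^+ 3 =
  \int[gauss]_y (6 * `|a| ^+ 3 * e ^+ 3 * `|y : R| ^+ 3) by rewrite RintegralZl// mulrAC.
apply: le_Rintegral => //.
- exact: (integrable_abse iB).
- exact: (integrableZl measurableT (6 * `|a| ^+ 3 * e ^+ 3) i3).
move=> y _; have := @lse_taylor _ _ M0 z a (y * e).
rewrite normrM exprMn (ger0_norm e0) scalerA -/A -/S => h.
rewrite [leRHS](_ : _ = 6 * `|a| ^+ 3 * (`|y| * e) ^+ 3); last by ring.
rewrite (le_trans _ h)// le_eqVlt; apply/orP; left; apply/eqP; congr `|_|.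
by field.
Qed.

(** Induction on the directions. A new direction also averages the second-order term already
    collected; [softvar] being Lipschitz, this moves it by [O(e)], and the prefactor [e^2] makes the
    change [O(e^3)]. *)
Lemma gauss_avgs_lse_step (J : Type) (a : J -> V) (s : seq J) :
  exists2 K : R, 0 <= K & forall e, 0 < e <= 1 -> forall z,
    `|gauss_avgs (fun j => e *: a j) s lse z -
      (lse z + e ^+ 2 / 2 * (\int[gauss]_y (y : R) ^+ 2) * \sum_(j <- s) softvar (a j) z)|
    <= K * e ^+ 3.
Proof.
set m2 := \int[gauss]_y (y : R) ^+ 2; set m1 := \int[gauss]_y `|y : R|.
have m20 : 0 <= m2 by apply: Rintegral_ge0 => y _; exact: sqr_ge0.
have m10 : 0 <= m1 by apply: Rintegral_ge0 => y _.
set m3 := \int[gauss]_y `|y : R| ^+ 3.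
have m30 : 0 <= m3 by apply: Rintegral_ge0 => y _; exact: exprn_ge0.
have llse : lip (@lse R M) by exact: lip_lse.
elim: s => [|j s [K K0 IH]].
  exists 0 => // e _ z; rewrite big_nil mulr0 addr0 /= subrr normr0.
  by rewrite mul0r.
pose D := \sum_(i <- s) 6 * `|a i| ^+ 2 * `|a j| * m1.
have D0 : 0 <= D by apply: sumr_ge0 => i _; rewrite !mulr_ge0// exprn_ge0.
exists (K + 6 * `|a j| ^+ 3 * m3 + m2 / 2 * D).
  by rewrite !addr_ge0 ?mulr_ge0 ?exprn_ge0 ?invr_ge0.
move=> e e01 z; have /andP[e0 e1] := e01.
rewrite gauss_avgs_cons//.
pose S x := \sum_(i <- s) softvar (a i) x.
have lS : lip S by apply: lip_sum => i; exact: lip_softvar.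
have lG : lip (fun x => lse x + e ^+ 2 / 2 * m2 * S x) by apply: lipD => //; exact: lipZ.
have := gauss_avg_dist (e *: a j) z (lip_gauss_avgs _ _ llse) lG (IH e e01).
set q := gauss_avg _ (gauss_avgs _ _ _) z => h1.
rewrite gauss_avgD// in h1; last exact: lipZ.
rewrite gauss_avgZ// in h1.
have h2 := gauss_avg_lse_step (a j) z (ltW e0).
have h3 : `|gauss_avg (e *: a j) S z - S z| <= D * e.
  rewrite gauss_avg_sum; last by move=> i; exact: lip_softvar.
  rewrite -sumrB (le_trans (ler_norm_sum _ _ _))// mulr_suml; apply: ler_sum => i _.
  have C0 : 0 <= 6 * `|a i| ^+ 2 by rewrite mulr_ge0// exprn_ge0.
  apply: (le_trans (gauss_avg_lip_dist _ _ C0 (softvar_lip_bound M0 (a i)))).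
  rewrite normrZ (ger0_norm (ltW e0)) -/m1 le_eqVlt; apply/orP; left; apply/eqP.
  by ring.
rewrite big_cons -/(S z).
have -> : q - (lse z + e ^+ 2 / 2 * m2 * (softvar (a j) z + S z)) =
  (q - (gauss_avg (e *: a j) lse z + e ^+ 2 / 2 * m2 * gauss_avg (e *: a j) S z)) +
  (gauss_avg (e *: a j) lse z - (lse z + e ^+ 2 / 2 * m2 * softvar (a j) z)) +
  e ^+ 2 / 2 * m2 * (gauss_avg (e *: a j) S z - S z) by ring.
rewrite (le_trans (ler_normD _ _))// [leRHS]mulrDl lerD//.
  by rewrite (le_trans (ler_normD _ _))// [leRHS]mulrDl lerD.
rewrite normrM ger0_norm; last by rewrite !mulr_ge0 ?exprn_ge0 ?invr_ge0// ltW.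
have -> : m2 / 2 * D * e ^+ 3 = e ^+ 2 / 2 * m2 * (D * e) by ring.
by rewrite ler_wpM2l// !mulr_ge0 ?exprn_ge0 ?invr_ge0// ltW.
Qed.

(** The Sudakov-Fernique comparison for log-sum-exp. Through [softvarE] the hypothesis on increments
    orders the second-order terms of one step, which carry the same second moment on both sides. *)
Lemma gauss_avgs_lse_compare (J J' : Type) (a : J -> V) (b : J' -> V) (s : seq J) (t : seq J') z :
  (forall i j, \sum_(k <- s) (a k 0 i - a k 0 j) ^+ 2 <= \sum_(k <- t) (b k 0 i - b k 0 j) ^+ 2) ->
  gauss_avgs a s lse z <= gauss_avgs b t lse z.
Proof.
move=> ab; have [K K0 aK] := gauss_avgs_lse_step a s; have [L L0 bL] := gauss_avgs_lse_step b t.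
apply: (@gauss_avgs_compare _ _ _ _ _ _ _ _ _ (K + L)) => //; [exact: lip_lse|exact: addr_ge0|].
move=> e e01 x; have := aK e e01 x; have := bL e e01 x.
have /andP[e0 e1] := e01.
set m2 := \int[gauss]_y (y : R) ^+ 2.
have m20 : 0 <= m2 by apply: Rintegral_ge0 => y _; exact: sqr_ge0.
have sv (I : Type) (c : I -> V) (r : seq I) : \sum_(k <- r) softvar (c k) x =
  (\sum_i \sum_j expR (x 0 i) * expR (x 0 j) * \sum_(k <- r) (c k 0 i - c k 0 j) ^+ 2) /
  (2 * sumexp (fun=> 1) x ^+ 2).
  under eq_bigr do rewrite softvarE//.
  rewrite -mulr_suml; congr (_ / _); rewrite exchange_big/=; apply: eq_bigr => i _.
  by rewrite exchange_big/=; apply: eq_bigr => j _; rewrite mulr_sumr.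
have : e ^+ 2 / 2 * m2 * \sum_(k <- s) softvar (a k) x <=
    e ^+ 2 / 2 * m2 * \sum_(k <- t) softvar (b k) x.
  apply: ler_wpM2l; first by rewrite !mulr_ge0 ?exprn_ge0 ?invr_ge0// ltW.
  rewrite !sv; apply: ler_wpM2r; first by rewrite invr_ge0 mulr_ge0// sqr_ge0.
  apply: ler_sum => i _; apply: ler_sum => j _; apply: ler_wpM2l; last exact: ab.
  by rewrite mulr_ge0// expR_ge0.
rewrite !ler_distl mulrDl => h /andP[h1 h2] /andP[h3 h4]; lra.
Qed.

End lse_comparison.

(** * Independent Gaussian variables *)

Section separable_bound.
Context {R : realType} {M : nat} {J : eqType}.
Local Notation V := ('rV[R]_M).
Local Notation gauss := (normal_prob (0 : R) (1 : R)).

(** Averaging one coordinate replaces its [psi] by the mean of [psi], which joins the constant; the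
    induction is therefore on [s] with [c] general. *)
Lemma gauss_avgs_separable_bound (b : J -> V) (s : seq J) (F : V -> R) (psi : R -> R) (c : R) :
  uniq s -> lip F -> gauss.-integrable setT (fun y : R => (psi y)%:E) ->
  (forall y : J -> R, F (\sum_(j <- s) y j *: b j) <= c + \sum_(j <- s) psi (y j)) ->
  gauss_avgs b s F 0 <= c + (size s)%:R * \int[gauss]_y psi (y : R).
Proof.
move=> + + ipsi; elim: s F c => [|j s IH] F c /= us lF Fpsi.
  by have := Fpsi (fun=> 0); rewrite !big_nil mul0r !addr0.
have /andP[js us'] := us.
set m := \int[gauss]_y psi (y : R) in IH *.
rewrite (le_trans (IH _ (c + m) us' (gauss_avg_lip _ lF) _))//; last first.
  by rewrite -natr1 mulrDl mul1r [_ * m + m]addrC addrA.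
move=> y.
have ic (r : R) := integrable_prob_cst gauss r.
have -> : c + m + \sum_(k <- s) psi (y k) = \int[gauss]_t (c + \sum_(k <- s) psi (y k) + psi (t :
  R)).
  have := RintegralD measurableT (ic (c + \sum_(k <- s) psi (y k))) ipsi.
  by rewrite gauss_Rintegral_cst => ->; rewrite addrAC.
apply: le_Rintegral => //; first exact: lip_line_integrable.
  exact: (integrableD measurableT (ic _) ipsi).
(* By [uniq], setting the coordinate [j] to [t] leaves the terms of the tail unchanged. *)
move=> t _; have := Fpsi (fun k => if k == j then t else y k).
rewrite !big_cons eqxx.
have nj k : k \in s -> (k == j) = false by move=> ks; apply: contraNF js => /eqP <-.
under eq_big_seq => k ks do rewrite nj//.
under [X in _ <= _ + (_ + X) -> _]eq_big_seq => k ks do rewrite nj//.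
by rewrite [t *: _ + _]addrC [psi t + _]addrC addrA.
Qed.

End separable_bound.

Section joint_law.
Context {R : realType} d (T : measurableType d) (P : probability T R).

Section joint_independence.
Context {J : finType} (D : {set J}) (X : J -> {RV P >-> R}).
Hypothesis indX : independent_on D X.

(* The space [S] is the iterated product of one copy of [R] per index in [s];
   [pi j] is the projection on the coordinate [j]. *)
Lemma independent_joint (s : seq J) : uniq s -> {subset s <= D} ->
  exists d' (S : measurableType d') (V : {mfun T >-> S}) (pi : J -> S -> R),
  [/\ forall j, measurable_fun [set: S] (pi j),
      forall j w, j \in s -> pi j (V w) = X j w &
      forall (B : set S) (K : {set J}) (E : J -> set R), measurable B ->
        K \subset D -> (forall i, i \in K -> i \notin s) -> (forall i, i \in K -> measurable (E
          i)) ->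
        (P (V @^-1` B `&` \bigcap_(i in [set` K]) (X i @^-1` E i)) =
         P (V @^-1` B) * P (\bigcap_(i in [set` K]) (X i @^-1` E i)))%E].
Proof.
elim: s => [_ _|j s IH /= /andP[js us] sD].
  exists default_measure_display, unit, (cst tt), (fun _ _ => 0); split => //.
  move=> B K E _ _ _ _; have [Btt|Btt] := pselect (B tt).
    have -> : @cst T unit tt @^-1` B = setT by apply/seteqP; split.
    by rewrite setTI probability_setT mul1e.
  have -> : @cst T unit tt @^-1` B = set0 by apply/seteqP; split.
  by rewrite set0I measure0 mul0e.
have [|d' [S [V [pi [mpi piX indV]]]]] := IH us.
  by move=> k ks; apply: sD; rewrite inE ks orbT.
have jD : j \in D by apply: sD; rewrite inE eqxx.
pose SR := (S * measurableTypeR R)%type.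
have mVX : measurable_fun [set: T] (fun w => (V w, X j w) : SR).
  by apply: measurable_fun_pair => //; exact: (measurable_funPT (X j)).
pose VX : {mfun T >-> SR} := HB.pack (fun w => (V w, X j w) : SR)
  (isMeasurableFun.Build _ _ _ _ _ mVX).
exists _, SR, VX, (fun k (u : SR) => if k == j then u.2 : R else pi k u.1); split.
- move=> k; case: eqP => _; first exact: measurable_snd.
  exact: (measurableT_comp (mpi k)).
- move=> k w; rewrite inE; case: eqP => [->|_] //= ks; exact: piX.
move=> B K E mB KD dKs mE.
have jK : j \notin K by apply/negP => /dKs; rewrite inE eqxx.
have dKs' i : i \in K -> i \notin s by move=> /dKs; rewrite inE => /norP[].
pose DK := \bigcap_(i in [set` K]) (X i @^-1` E i).
have mDK : measurable DK.
  apply: fin_bigcap_measurable => // i iK.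
  by rewrite -[X in measurable X]setTI; apply: measurable_funPT => //; exact: mE.
have PDK0 : 0 <= fine (P DK) by rewrite fine_ge0.
have PDKE : (fine (P DK))%:E = P DK by rewrite fineK// fin_num_measure.
(* As functions of the event on [VX], the joint probability with [DK] and the product of
   probabilities are finite measures. It suffices that they agree on rectangles, a pi-system
   generating the product sigma-algebra. *)
pose m1' : {measure set SR -> \bar R} :=
  pushforward (mrestr P mDK) VX.
pose m1 := m1' mVX.
pose m2 : {measure set SR -> \bar R} := mscale (NngNum PDK0) (distribution P VX).
have m1E C : m1 C = P (VX @^-1` C `&` DK) by [].
have m2E C : m2 C = (P DK * P (VX @^-1` C))%E by rewrite -PDKE.
suff : m1 B = m2 B by rewrite m1E m2E muleC.
pose C : set (set SR) :=
  [set C | exists A, measurable A /\ exists B, measurable B /\ C = A `*` B].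
apply: (measure_unique C (fun=> setT)) => //.
- rewrite measurable_prod_measurableType//; congr (<<s _ >>).
  rewrite predeqE; split => [[A1 mA [B1 mB1 <-]]|[A1 [mA [B1 [mB1 ->]]]]].
    by exists A1; split => //; exists B1.
  by exists A1 => //; exists B1.
- move=> /= _ _ [X1 [mX1 [X2 [mX2 ->]]]] [Y1 [mY1 [Y2 [mY2 ->]]]].
  rewrite -setXI; exists (X1 `&` Y1); split; first exact: measurableI.
  by exists (X2 `&` Y2); split => //; exact: measurableI.
- by move=> _; exists setT; split => //; exists setT; split => //; rewrite setXTT.
- by rewrite bigcup_const//; exists 0%N.
- move=> _ [A1 [mA [B1 [mB1 ->]]]]; rewrite m1E m2E.
  have -> : VX @^-1` (A1 `*` B1) = V @^-1` A1 `&` (X j @^-1` B1) by [].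
  (* On a rectangle the condition on [X j] joins the family [K], so the induction hypothesis is used
     for [j |: K]. Hence independence is stated against whole finite families rather than a single
     variable. *)
  pose E' k := if k == j then B1 else E k.
  have EK (L : {set J}) : j \notin L -> \bigcap_(i in [set` L]) (X i @^-1` E' i) =
      \bigcap_(i in [set` L]) (X i @^-1` E i).
    move=> jL; apply: eq_bigcapr => i /= iL; rewrite /E' ifN//.
    by apply: contraNneq jL => <-.
  have Ej : X j @^-1` B1 = \bigcap_(i in [set` [set j]%SET]) (X i @^-1` E' i).
    rewrite (_ : [set` [set j]%SET] = [set j]); last first.
      by apply/seteqP; split => i /=; rewrite inE => /eqP.
    by rewrite bigcap_set1 /E' eqxx.
  have EjK : X j @^-1` B1 `&` DK = \bigcap_(i in [set` (j |: K)%SET]) (X i @^-1` E' i).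
    rewrite /DK -(EK K jK) Ej -bigcap_setU; congr bigcap.
    apply/seteqP; split => i /=; rewrite !inE.
      by case=> ->; rewrite ?orbT.
    by case/orP => h; [left|right].
  have mE' (L : {set J}) i : (L \subset j |: K)%SET -> i \in L -> measurable (E' i).
    move=> /fintype.subsetP LK /LK; rewrite /E' !inE; case: eqP => //= _; exact: mE.
  have jKD : (j |: K)%SET \subset D by rewrite finset.subUset finset.sub1set jD.
  have jKs i : i \in (j |: K)%SET -> i \notin s.
    by rewrite !inE => /orP[/eqP->//|]; exact: dKs'.
  rewrite -setIA EjK indV//; last by move=> i; exact: mE'.
  rewrite [in RHS]Ej indV//; last 3 first.
  - by rewrite finset.sub1set.
  - by move=> i; rewrite inE => /eqP->.
  - by move=> i; apply: mE'; rewrite finset.sub1set !inE eqxx.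
  rewrite indX//; last by move=> i; exact: mE'.
  rewrite indX//; [|by rewrite finset.sub1set|by move=> i; apply: mE';
    rewrite finset.sub1set !inE eqxx].
  rewrite /DK -(EK K jK) indX//; last by move=> i; apply: mE'; exact: finset.subsetUr.
  by rewrite big_setU1//= big_set1 [RHS]muleC muleA.
- move=> _; rewrite m1E preimage_setT setTI.
  by rewrite -ge0_fin_numE// fin_num_measure.
Qed.
End joint_independence.
End joint_law.

Section gaussian_expectation.
Context {R : realType} d (T : measurableType d) (P : probability T R).
Local Notation gauss := (normal_prob (0 : R) (1 : R)).

Lemma gaussian_rv_integrable (X : {RV P >-> R}) (v : R) : 0 < v -> gaussian_rv X 0 v ->
  P.-integrable setT (fun w => (X w)%:E).
Proof.
move=> v0 gX; apply/integrableP; split; first exact/measurable_EFinP.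
have sv : 0 < Num.sqrt v by rewrite sqrtr_gt0.
have cn : continuous (fun y : R => `|y|) by exact: norm_continuous.
have mn : measurable_fun [set: R] (fun y : R => `|y|%:E) by apply/measurable_EFinP;
  exact: normr_measurable.
have n0 (y : R) : (0 <= `|y|%:E)%E by rewrite lee_fin.
have mX' : measurable_fun [set: T] (fun w => X w : measurableTypeR R) := measurable_funPT X.
pose X' : {mfun T >-> measurableTypeR R} := HB.pack (fun w => X w : measurableTypeR R)
  (isMeasurableFun.Build _ _ _ _ _ mX').
have -> : (\int[P]_w `|(X w)%:E| = \int[distribution P X']_y (`|y : R|)%:E)%E.
  exact: (esym (ge0_integral_distribution X' mn n0)).
rewrite (eq_measure_integral (normal_prob 0 (Num.sqrt v))) => [|E mE _]; last exact: gX.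
rewrite (ge0_integral_normal_affine 0 sv cn); last by move=> y.
have /integrableP[_] := integrableZl measurableT (Num.sqrt v) (@gauss_integrable_id R).
apply: le_lt_trans; rewrite le_eqVlt; apply/orP; left; apply/eqP.
by apply: eq_integral => y _; rewrite add0r.
Qed.

(** Independence makes the law of [(V, X)] a product; integrating the second factor first turns it
    into a Gaussian average along [c]. *)
Lemma gaussian_expectation_avg {M : nat} d' (S : measurableType d') (V : {mfun T >-> S})
    (W : S -> 'rV[R]_M) (X : {RV P >-> R}) (v : R) (c : 'rV[R]_M) (F : 'rV[R]_M -> R) :
  lip F -> 0 < v -> gaussian_rv X 0 v ->
  (forall i, measurable_fun [set: S] (fun s => W s 0 i)) ->
  (forall i, P.-integrable setT (fun w => (W (V w) 0 i)%:E)) ->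
  (forall B E, measurable B -> measurable E ->
     P (V @^-1` B `&` X @^-1` E) = P (V @^-1` B) * P (X @^-1` E))%E ->
  (\int[P]_w (F (W (V w) + X w *: c))%:E =
   \int[P]_w (gauss_avg (Num.sqrt v *: c) F (W (V w)))%:E)%E.
Proof.
move=> lF v0 gX mW iW indVX.
have sv : 0 < Num.sqrt v by rewrite sqrtr_gt0.
have iX := gaussian_rv_integrable v0 gX.
pose SR := (S * measurableTypeR R)%type.
have mVX : measurable_fun [set: T] (fun w => (V w, X w) : SR).
  by apply: measurable_fun_pair => //; exact: (measurable_funPT X).
pose VX : {mfun T >-> SR} := HB.pack (fun w => (V w, X w) : SR)
  (isMeasurableFun.Build _ _ _ _ _ mVX).
pose mS : probability S R := distribution P V.
have mX' : measurable_fun [set: T] (fun w => X w : measurableTypeR R) := measurable_funPT X.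
pose X' : {mfun T >-> measurableTypeR R} := HB.pack (fun w => X w : measurableTypeR R)
  (isMeasurableFun.Build _ _ _ _ _ mX').
pose mX : probability (measurableTypeR R) R := distribution P X'.
have iWX i : P.-integrable setT (fun w => ((W (V w) + X w *: c) 0 i)%:E).
  under eq_fun do rewrite 2!mxE EFinD mulrC EFinM.
  by apply: integrableD => //; apply: integrableZl.
have iF := lip_integrable (probT_lty P) lF iWX.
pose f (u : SR) := (F (W u.1 + (u.2 : R) *: c))%:E.
have mf : measurable_fun [set: SR] f.
  apply/measurable_EFinP; apply: (lip_measurable lF (W := fun u : SR => W u.1 + (u.2 : R) *: c)).
  move=> i; under eq_fun do rewrite 2!mxE.
  apply: measurable_funD; first exact: (measurableT_comp (mW i)).
  by apply: measurable_funM => //; exact: measurable_snd.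
have -> : (\int[P]_w (F (W (V w) + X w *: c))%:E = \int[distribution P VX]_u f u)%E.
  exact: (esym (integral_distribution (X := VX) mf iF)).
have prodE A : measurable A -> distribution P VX A = (mS \x mX)%E A.
  move=> mA; apply/esym; apply: product_measure_unique mA => B E mB mE.
  exact: (indVX B E mB mE).
have imS i : mS.-integrable setT (fun s => (W s 0 i)%:E).
  have mWi : measurable_fun [set: S] (fun s => (W s 0 i)%:E) by apply/measurable_EFinP; exact: mW.
  exact: (integrable_pushforward (measurable_funPT V) mWi (iW i) measurableT).
have imX : mX.-integrable setT (fun y : R => y%:E).
  have mid : measurable_fun [set: measurableTypeR R] (fun y : R => y%:E) by exact/measurable_EFinP.
  exact: (integrable_pushforward mX' mid iX measurableT).
rewrite (eq_measure_integral (mS \x mX)%E) => [|A mA _]; last exact: prodE.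
have iprod : (mS \x mX)%E.-integrable setT f.
  apply: (@lip_integrable _ _ _ _ (mS \x mX)%E (fun u : SR => W u.1 + (u.2 : R) *: c)) => //.
    by rewrite [X in (X < _)%E](product_probT mS mX) ltry.
  move=> i; under eq_fun do rewrite 2!mxE EFinD mulrC EFinM.
  apply: integrableD => //; first exact: (integrable_fst mX (imS i)).
  apply: integrableZl => //; exact: (@integrable_snd _ _ _ _ _ mS mX (fun y => (y : R)%:E)).
rewrite -(integral12_prod_meas1 iprod).
have QfE s : fubini_F mX f s = (gauss_avg (Num.sqrt v *: c) F (W s))%:E.
  rewrite -(integral_normal_line c (W s) sv lF) /fubini_F.
  by apply: eq_measure_integral => E mE _; exact: gX.
have lQ : lip (gauss_avg (Num.sqrt v *: c) F) by exact: gauss_avg_lip.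
transitivity (\int[mS]_s (gauss_avg (Num.sqrt v *: c) F (W s))%:E)%E.
  by apply: eq_integral => s _; exact: QfE.
have mQ : measurable_fun [set: S] (fun s => (gauss_avg (Num.sqrt v *: c) F (W s))%:E).
  by apply/measurable_EFinP; exact: lip_measurable.
exact: (integral_distribution (X := V) mQ (lip_integrable (probT_lty P) lQ iW)).
Qed.

(** The bridge from the probability space to iterated averages: the head variable is integrated out
    given the joint vector of the others, supplied by [independent_joint]. *)
Lemma gaussian_expectation_avgs {M : nat} (J : finType) (D : {set J}) (X : J -> {RV P >-> R})
    (v : J -> R) (c : J -> 'rV[R]_M) (F : 'rV[R]_M -> R) (z : 'rV[R]_M) (s : seq J) :
  independent_on D X -> lip F -> uniq s -> {subset s <= D} ->
  (forall j, j \in D -> 0 < v j) -> (forall j, j \in D -> gaussian_rv (X j) 0 (v j)) ->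
  (\int[P]_w (F (z + \sum_(j <- s) X j w *: c j))%:E =
   (gauss_avgs (fun j => Num.sqrt (v j) *: c j) s F z)%:E)%E.
Proof.
move=> indX + + + v0 gX; elim: s F => [|j s IH] F lF us sD.
  under eq_integral do rewrite big_nil addr0.
  exact: integral_prob_cst.
have /= /andP[js us'] := us.
have sD' : {subset s <= D} by move=> k ks; apply: sD; rewrite inE ks orbT.
have jD : j \in D by apply: sD; rewrite inE eqxx.
have [d' [S [V [pi [mpi piX indV]]]]] := independent_joint indX us' sD'.
pose W (x : S) := z + \sum_(k <- s) pi k x *: c k.
have WE w : W (V w) = z + \sum_(k <- s) X k w *: c k.
  by rewrite /W; congr (_ + _); apply: eq_big_seq => k ks; rewrite piX.
rewrite /= -IH//; last exact: gauss_avg_lip.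
under eq_integral do rewrite big_cons [_ *: _ + _]addrC addrA -WE.
under [RHS]eq_integral do rewrite -WE.
apply: gaussian_expectation_avg => //; [exact: v0|exact: gX|..].
- move=> i; rewrite /W; under eq_fun do rewrite mxE summxE.
  apply: measurable_funD => //; apply: measurable_sum => k.
  by under eq_fun do rewrite mxE; apply: measurable_funM.
- move=> i; under eq_fun do rewrite WE mxE summxE.
  under eq_fun do rewrite EFinD -sumEFin.
  apply: integrableD => //; first exact: integrable_prob_cst.
  rewrite (_ : (fun w => _) =
      (fun w => \sum_(k <- s | k \in s) ((c k 0 i)%:E * (X k w)%:E))%E); last first.
    by apply/funext => w; rewrite big_seq; apply: eq_bigr => k _; rewrite mxE mulrC EFinM.
  apply: integrable_sum => // k ks; apply: integrableZl => //.
  by apply: gaussian_rv_integrable (gX _ (sD' _ ks)); exact: v0 (sD' _ ks).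
- move=> B E mB mE.
  have := indV B [set j]%SET (fun=> E) mB.
  rewrite (_ : [set` [set j]%SET] = [set j]); last first.
    by apply/seteqP; split => i /=; rewrite inE => /eqP.
  rewrite bigcap_set1; apply => //.
  + by rewrite finset.sub1set.
  + by move=> i; rewrite inE => /eqP->.
Qed.

End gaussian_expectation.

Section lse_bounds.
Context {R : realType} {M : nat}.
Hypothesis M0 : (0 < M)%N.

(** With [lse_lb], log-sum-exp exceeds the maximum of the coordinates by at most [ln M]; at scale
    [be] the error becomes [ln M / be]. *)
Lemma lse_ub (z : 'rV[R]_M) (B : R) : (forall l, z 0 l <= B) -> lse z <= ln M%:R + B.
Proof.
move=> zB; have Mp : 0 < M%:R :> R by rewrite ltr0n.
rewrite -[X in _ + X]expRK -lnM ?posrE ?expR_gt0// ler_ln ?posrE ?sumexp1_gt0//; last first.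
  by rewrite mulr_gt0// expR_gt0.
rewrite /sumexp (@le_trans _ _ (\sum_(i < M) expR B))//.
  by apply: ler_sum => i _; rewrite mulr1 ler_expR.
by rewrite sumr_const card_ord mulr_natl.
Qed.

Lemma lse_lb (z : 'rV[R]_M) l : z 0 l <= lse z.
Proof.
rewrite -[leLHS]expRK ler_ln ?posrE ?expR_gt0 ?sumexp1_gt0//.
rewrite /sumexp (bigD1 l)//= mulr1 lerDl; apply: sumr_ge0 => i _.
by rewrite mulr1 expR_ge0.
Qed.

End lse_bounds.

Section absolute_moments.
Context {R : realType}.
Local Notation gauss := (normal_prob (0 : R) (1 : R)).

Definition gauss_moment (p : R) := \int[gauss]_y (`|y : R| `^ p).

Lemma gauss_integrable_powR (p : R) : 0 <= p <= 4 ->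
  gauss.-integrable setT (fun y : R => (`|y| `^ p)%:E).
Proof.
move=> /andP[p0 p4]; apply: (@gauss_integrable _ 1 (fun y => `|y| `^ p)).
  exact: (measurableT_comp (measurable_powR p) (@normr_measurable R setT)).
move=> y; rewrite mul1r ger0_norm ?powR_ge0//.
have [y1|y1] := leP `|y| 1.
  rewrite (@le_trans _ _ 1) ?lerDl ?exprn_even_ge0//.
  by have := ge0_ler_powR p0 _ _ y1; rewrite powR1; apply; rewrite nnegrE.
rewrite (@le_trans _ _ (`|y| `^ 4%:R))//; first by rewrite ler_powR// ltW.
by rewrite powR_mulrn// -normrX ger0_norm ?exprn_even_ge0// lerDr.
Qed.

(** Young with exponents [2/p] and [2/(2-p)] gives [|y|^p <= 1 - p/2 + (p/2) y^2]. The case [p = 2],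
    where the second exponent degenerates, is the second moment itself. *)
Lemma gauss_moment_le1 (p : R) : 0 < p -> p <= 2 -> gauss_moment p <= 1.
Proof.
move=> p0; rewrite le_eqVlt => /predU1P[->|p2].
  rewrite /gauss_moment (_ : \int[gauss]_y _ = \int[gauss]_y (y : R) ^+ 2).
    exact: gauss_sqr_le1.
  apply: eq_Rintegral => y _.
  by rewrite -[2]/(2%:R) powR_mulrn// -normrX ger0_norm ?sqr_ge0.
have i2 := @gauss_integrable_sqr R.
have ic := integrable_prob_cst gauss (1 - p / 2).
have j2 : gauss.-integrable setT (fun y : R => (p / 2 * y ^+ 2)%:E).
  exact: (integrableZl measurableT (p / 2) i2).
have ij : gauss.-integrable setT (fun y : R => (1 - p / 2 + p / 2 * y ^+ 2)%:E).
  exact: (integrableD measurableT ic j2).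
apply: (@le_trans _ _ (\int[gauss]_y (1 - p / 2 + p / 2 * (y : R) ^+ 2))).
  apply: le_Rintegral => //; first by apply: gauss_integrable_powR; apply/andP; split; lra.
  move=> y _.
  have := @conjugate_powR R (`|y| `^ p) 1 (2 / p) (2 / (2 - p)) (powR_ge0 _ _) ler01
    ltac:(rewrite divr_gt0//) ltac:(rewrite divr_gt0// subr_gt0//) ltac:(field; apply/andP;
      split; lra).
  rewrite mulr1 -powRrM powR1 !invf_div.
  have -> : p * (2 / p) = 2%:R by rewrite mulrC divfK// gt_eqF.
  by rewrite powR_mulrn// -normrX (ger0_norm (sqr_ge0 y)); lra.
rewrite RintegralD// gauss_Rintegral_cst RintegralZl//.
have := gauss_sqr_le1 (R := R); set m2 := \int[gauss]_y _ => h.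
have : p / 2 * m2 <= p / 2 by rewrite ler_piMr//; lra.
lra.
Qed.

(** Pointwise [1 - exp (- 3/2 y^2) <= 3/2 |y|^p], by [p <= 2] when [|y| <= 1] and trivially beyond.
    The left side has mean [1/2], by [gauss_expR_sqr] at [s = 1/2]. *)
Lemma gauss_moment_gt0 (p : R) : 0 < p -> p <= 2 -> 0 < gauss_moment p.
Proof.
move=> p0 p2; have k3 : (2^-1 ^- 2 - 1) / 2 = 3 / 2 :> R by field.
have E : \int[gauss]_y (1 - expR (- (3 / 2 * (y : R) ^+ 2))) = 1 - 2^-1.
  have ic := integrable_prob_cst gauss (1 : R).
  have ie : gauss.-integrable setT (fun y : R => (expR (- (3 / 2 * y ^+ 2)))%:E).
    apply: (@gauss_integrable _ 1 (fun y => expR (- (3 / 2 * y ^+ 2)))).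
      apply: measurableT_comp => //; apply: measurableT_comp => //.
      by apply: measurable_funM => //; exact: measurable_funX.
    move=> y; rewrite mul1r ger0_norm ?expR_ge0// (@le_trans _ _ 1)//.
      rewrite -expR0 ler_expR oppr_le0 mulr_ge0 ?sqr_ge0// divr_ge0.
    by rewrite lerDl exprn_even_ge0.
  rewrite RintegralB// gauss_Rintegral_cst; congr (_ - _).
  have := @gauss_expR_sqr R 2^-1; rewrite k3 /Rintegral => -> //; lra.
have ip : gauss.-integrable setT (fun y : R => (`|y| `^ p)%:E).
  by apply: gauss_integrable_powR; apply/andP; split; lra.
have ip2 : gauss.-integrable setT (fun y : R => (3 / 2 * `|y| `^ p)%:E).
  exact: (integrableZl measurableT (3 / 2) ip).
have h : 1 - 2^-1 <= 3 / 2 * gauss_moment p.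
  rewrite -E /gauss_moment -RintegralZl//; apply: le_Rintegral => //.
    apply: (@gauss_integrable _ 1 (fun y => 1 - expR (- (3 / 2 * y ^+ 2)))).
      apply: measurable_funB => //.
      apply: measurableT_comp => //; apply: measurableT_comp => //.
      by apply: measurable_funM => //; exact: measurable_funX.
    move=> y; rewrite mul1r.
    have e0 := expR_gt0 (- (3 / 2 * y ^+ 2)).
    have e1 : expR (- (3 / 2 * y ^+ 2)) <= 1.
      rewrite -expR0 ler_expR oppr_le0 mulr_ge0 ?sqr_ge0// divr_ge0.
    rewrite ger0_norm ?subr_ge0//; apply: (@le_trans _ _ 1); first by lra.
    by rewrite lerDl exprn_even_ge0.
  move=> y _.
  have [y1|y1] := leP `|y| 1.
    rewrite (@le_trans _ _ (3 / 2 * y ^+ 2))//.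
      by have := expR_ge1Dx (- (3 / 2 * y ^+ 2)); lra.
    have [->|yn0] := eqVneq y 0; first by rewrite expr0n/= mulr0 mulr_ge0// powR_ge0.
    rewrite ler_wpM2l//.
    rewrite -real_normK ?num_real// -powR_mulrn//.
    by rewrite ger_powR// normr_gt0 yn0.
  have : 1 <= `|y| `^ p.
    by rewrite -(powRr0 `|y|) ler_powR// ltW.
  by have := expR_gt0 (- (3 / 2 * y ^+ 2)); lra.
lra.
Qed.

End absolute_moments.

(** * Expected suprema *)

Section lse_expectation.
Context {R : realType} d (T : measurableType d) (P : probability T R).
Local Notation gauss := (normal_prob (0 : R) (1 : R)).

(** Young for [lam |y|] and [|u| / lam], with [q / (q - 1)] the exponent conjugate to [q]. *)
Lemma young_exprn (q : nat) (lam y u : R) : (2 <= q)%N -> 0 < lam ->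
  y * u <= (lam `^ (q%:R / (q%:R - 1)) / (q%:R / (q%:R - 1))) * `|y| `^ (q%:R / (q%:R - 1)) +
           (q%:R * lam ^+ q)^-1 * `|u| ^+ q.
Proof.
move=> q2 l0; set p := q%:R / (q%:R - 1).
have q2R : 2 <= q%:R :> R by rewrite (ler_nat _ 2).
have q1 : 0 < q%:R - 1 :> R by lra.
have q0 : 0 < q%:R :> R by lra.
have p0 : 0 < p by rewrite divr_gt0.
have pq : p^-1 + q%:R^-1 = 1 by rewrite /p; field; rewrite !gt_eqF.
have ly : 0 <= lam * `|y| by rewrite mulr_ge0// ltW.
have ul : 0 <= `|u| / lam by rewrite divr_ge0// ltW.
rewrite (le_trans (ler_norm _))// normrM.
have := conjugate_powR ly ul p0 q0 pq.
have -> : lam * `|y| * (`|u| / lam) = `|y| * `|u| by field; rewrite gt_eqF.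
move=> /le_trans; apply; rewrite powRM ?(ltW l0)// powR_mulrn//.
have lq : 0 < lam ^+ q by rewrite exprn_gt0.
rewrite exprMn exprVn le_eqVlt; apply/orP; left; apply/eqP.
congr (_ + _); first by rewrite mulrAC.
by rewrite [RHS]mulrC invfM [q%:R^-1 * _]mulrC mulrA.
Qed.

(** Comparison with the process [be L <g, u l>], followed by a bound on its log-sum-exp that is
    uniform in [l] and separable in the coordinates of [g]. Here [be] is the inverse temperature and
    [lam] stays free. *)
Lemma expectation_lse_le {M n : nat} (J : finType) (D : {set J}) (X : J -> {RV P >-> R})
    (v : J -> R) (a : J -> 'rV[R]_M) (u : 'I_M -> 'I_n -> R) (q : nat) (p L be lam : R) :
  (0 < M)%N -> (2 <= q)%N -> 0 <= L -> 0 < be -> 0 < lam ->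
  independent_on D X -> (forall j, j \in D -> 0 < v j) ->
  (forall j, j \in D -> gaussian_rv (X j) 0 (v j)) ->
  (forall l, \sum_i `|u l i| ^+ q = 1) ->
  (forall l l', \sum_(j in D) v j * (a j 0 l - a j 0 l') ^+ 2 <=
     L ^+ 2 * \sum_i (u l i - u l' i) ^+ 2) ->
  p = q%:R / (q%:R - 1) ->
  (\int[P]_w (lse (\sum_(j in D) X j w *: (be *: a j)))%:E <=
   (ln M%:R + be * L * (lam `^ p / p * (n%:R * gauss_moment p) + (q%:R * lam ^+ q)^-1))%:E)%E.
Proof.
move=> M0 q2 L0 be0 lam0 indX v0 gX uq vL pE.
have q2R : 2 <= q%:R :> R by rewrite (ler_nat _ 2).
have q1 : 0 < q%:R - 1 :> R by lra.
have p0 : 0 < p by rewrite pE divr_gt0//; lra.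
have p2 : p <= 2 by rewrite pE ler_pdivrMr//; lra.
have llse : lip (@lse R M) by exact: lip_lse.
have -> : (\int[P]_w (lse (\sum_(j in D) X j w *: (be *: a j)))%:E =
    (gauss_avgs (fun j => Num.sqrt (v j) *: (be *: a j)) (enum D) lse 0)%:E)%E.
  rewrite -(gaussian_expectation_avgs _ 0 indX llse (enum_uniq (mem D)) _ v0 gX); last first.
    by move=> j; rewrite mem_enum.
  by apply: eq_integral => w _; rewrite add0r big_enum.
rewrite lee_fin.
pose b (i : 'I_n) : 'rV[R]_M := \row_l (be * L * u l i).
rewrite (@le_trans _ _ (gauss_avgs b (enum 'I_n) lse 0))//.
  apply: gauss_avgs_lse_compare => // l l'.
  rewrite big_enum/= (@le_trans _ _ (be ^+ 2 * \sum_(j in D) v j * (a j 0 l - a j 0 l') ^+ 2))//.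
    rewrite mulr_sumr; apply: ler_sum => j jD; rewrite !mxE -!mulrBr !exprMn sqr_sqrtr ?(ltW (v0
      _ jD))//.
    by rewrite mulrCA.
  rewrite (@le_trans _ _ (be ^+ 2 * (L ^+ 2 * \sum_i (u l i - u l' i) ^+ 2)))//.
    by rewrite ler_wpM2l// sqr_ge0.
  rewrite big_enum/= !mulr_sumr; apply: ler_sum => i _.
  by rewrite !mxE -mulrBr !exprMn mulrA.
pose psi (y : R) := be * L * (lam `^ p / p) * `|y| `^ p.
have ip : gauss.-integrable setT (fun y : R => (`|y| `^ p)%:E).
  by apply: gauss_integrable_powR; apply/andP; split; lra.
have ipsi : gauss.-integrable setT (fun y : R => (psi y)%:E).
  exact: (integrableZl measurableT (be * L * (lam `^ p / p)) ip).
have beL0 : 0 <= be * L by rewrite mulr_ge0// ltW.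
rewrite (le_trans (@gauss_avgs_separable_bound _ _ _ b (enum 'I_n) lse psi
  (ln M%:R + be * L * (q%:R * lam ^+ q)^-1) (enum_uniq _) llse ipsi _))//.
  move=> y; rewrite -addrA; apply: lse_ub => // l.
  rewrite summxE !big_enum/=.
  (* As [u l] lies on the [l^q] sphere, the constant is spread over the coordinates with weights
     [|u l i| ^+ q], and Young applies in each. *)
  have -> : be * L * (q%:R * lam ^+ q)^-1 =
      \sum_i be * L * ((q%:R * lam ^+ q)^-1 * `|u l i| ^+ q).
    by rewrite -!mulr_sumr uq mulr1.
  rewrite -big_split/=; apply: ler_sum => i _; rewrite !mxE.
  rewrite mulrCA /psi -[X in _ + X]mulrA -mulrDr ler_wpM2l// addrC.
  by rewrite pE; exact: young_exprn.
rewrite -cardE card_ord /psi RintegralZl// -/(gauss_moment p).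
by rewrite -addrA lerD2l mulrDr addrC lerD2r le_eqVlt; apply/orP; left; apply/eqP; ring.
Qed.

End lse_expectation.

(** * Tensor powers of vectors and their distances *)

Section monomials.
Context {R : realType} {n d : nat}.
Implicit Types (t s : d.-tuple 'I_n) (u v : 'rV[R]_n).

Definition monom (x : 'I_n -> R) t := \prod_(k < d) x (tnth t k).

Lemma monom_perm x s t : perm_eq s t -> monom x s = monom x t.
Proof.
move=> st; rewrite /monom -(big_tuple _ _ s xpredT x) -(big_tuple _ _ t xpredT x).
exact: perm_big.
Qed.

Lemma sum_monom (x : 'I_n -> R) : \sum_t monom x t = (\sum_i x i) ^+ d.
Proof.
rewrite -[in RHS](card_ord d) -prodr_const bigA_distr_bigA/=.
rewrite (reindex (fun t : d.-tuple 'I_n => [ffun k => tnth t k]))/=; last first.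
  exists (fun f : {ffun 'I_d -> 'I_n} => [tuple f k | k < d]) => [t _|f _].
    by apply: eq_from_tnth => k; rewrite tnth_mktuple ffunE.
  by apply/ffunP => k; rewrite ffunE tnth_mktuple.
by apply: eq_bigr => t _; apply: eq_bigr => k _; rewrite ffunE.
Qed.

(** Inner products of tensor powers are powers of inner products, which is [sum_monom] for the
    products [x i * y i]. *)
Lemma sum_monom_sqr_dist (x y : 'I_n -> R) :
  \sum_t (monom x t - monom y t) ^+ 2 =
  (\sum_i x i ^+ 2) ^+ d + (\sum_i y i ^+ 2) ^+ d - 2 * (\sum_i x i * y i) ^+ d.
Proof.
rewrite -!sum_monom mulr_sumr -big_split -sumrB/=; apply: eq_bigr => t _.
by rewrite /monom !prodrXl big_split/=; ring.
Qed.

(** Every permutation class has exactly one sorted member, so the tuples are partitioned along the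
    sorting map. *)
Lemma sum_sorted_index (f : d.-tuple 'I_n -> R) :
  (forall s t, perm_eq s t -> f s = f t) ->
  \sum_t f t = \sum_(t in sorted_index n d) #|index_perms t|%:R * f t.
Proof.
move=> fS; pose le_ord : rel 'I_n := fun i j => (i <= j)%N.
pose srt t : d.-tuple 'I_n := [tuple of sort le_ord t].
have tot : total le_ord by move=> i j; exact: leq_total.
have tra : transitive le_ord by move=> i j k; exact: leq_trans.
have asym : antisymmetric le_ord by move=> i j h; apply/val_inj/anti_leq.
have sortedE t : (t \in sorted_index n d) = sorted le_ord t.
  by rewrite inE sorted_map.
have srtS t : srt t \in sorted_index n d by rewrite sortedE sort_sorted.
rewrite (partition_big srt (fun s => s \in sorted_index n d))//=.
apply: eq_bigr => s; rewrite sortedE => sS.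
transitivity (\sum_(t in index_perms s) f s); last by rewrite sumr_const mulr_natl.
apply: eq_big => [t|t /eqP ts].
  rewrite inE; apply/eqP/idP => [<-|ts]; first by rewrite perm_sym perm_sort.
  apply/val_inj/(sorted_eq tra asym) => //=; first exact: sort_sorted.
  by rewrite perm_sort.
by rewrite -ts; apply: fS; rewrite perm_sym perm_sort.
Qed.

End monomials.

Section power_inequalities.
Context {R : realType}.
Implicit Types (a b c N : R).

(** Geometric factorisation, each power of [c] being at most 1; [c] will be the inner product of two
    Euclidean unit vectors. *)
Lemma one_subX_le c d : `|c| <= 1 -> 1 - c ^+ d <= d%:R * (1 - c).
Proof.
move=> c1; rewrite -opprB subrX1 -mulNr opprB mulrC ler_wpM2r//.
  by rewrite subr_ge0 (le_trans (ler_norm _)).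
rewrite (@le_trans _ _ (\sum_(i < d) 1))//; last by rewrite sumr_const card_ord.
apply: ler_sum => i _; rewrite (le_trans (ler_norm _))// normrX.
by rewrite exprn_ile1.
Qed.

(* [a], [b], [c] stand for [|u|^2], [|v|^2], [<u, v>]; the left-hand side is
   [|u^(x)k - v^(x)k|^2], and the induction is the triangle inequality for
   [u^(x)(k+1) - v^(x)(k+1) = (u - v) (x) u^(x)k + v (x) (u^(x)k - v^(x)k)]. *)
Lemma powers_dist_le a b c N k : 0 <= a <= N -> 0 <= b <= N -> c ^+ 2 <= a * b ->
  0 <= a + b - 2 * c ->
  a ^+ k.+1 + b ^+ k.+1 - 2 * c ^+ k.+1 <= k.+1%:R ^+ 2 * N ^+ k * (a + b - 2 * c).
Proof.
move=> /andP[a0 aN] /andP[b0 bN] cab D0; have N0 : 0 <= N := le_trans a0 aN.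
elim: k => [|k IH]; first by rewrite !expr1 expr0 expr1n !mul1r.
set D := a + b - 2 * c in D0 IH *.
set S := a ^+ k.+1 + b ^+ k.+1 - 2 * c ^+ k.+1 in IH.
have k0 : 0 < k.+1%:R :> R by rewrite ltr0n.
have ak0 : 0 <= a ^+ k.+1 by rewrite exprn_ge0.
have bk0 : 0 <= b ^+ k.+1 by rewrite exprn_ge0.
have ck : (c ^+ k.+1) ^+ 2 <= a ^+ k.+1 * b ^+ k.+1.
  by rewrite -exprM mulnC exprM -exprMn lerXn2r// nnegrE ?sqr_ge0// mulr_ge0.
have S0 : 0 <= S.
  have h : 2 * c ^+ k.+1 <= a ^+ k.+1 + b ^+ k.+1.
    rewrite (le_trans (ler_norm _))// -(@ler_pXn2r _ 2)// ?nnegrE ?addr_ge0// real_normK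
      ?num_real//.
    have := sqr_ge0 (a ^+ k.+1 - b ^+ k.+1); nra.
  by rewrite subr_ge0.
(* [2 z] is the cross term of the squared norm, and [z^2 <= x y] is Cauchy-Schwarz. The weights
   [k+1] and [1/(k+1)] in [2 z <= x + y] make the constants add up:
   [(k+2) + (1 + 1/(k+1)) (k+1)^2 = (k+2)^2]. *)
pose x := k.+1%:R * D * a ^+ k.+1; pose y := b * S / k.+1%:R.
pose z := (c - b) * (a ^+ k.+1 - c ^+ k.+1).
have x0 : 0 <= x by rewrite !mulr_ge0// ltW.
have y0 : 0 <= y by rewrite divr_ge0 ?mulr_ge0// ltW.
have zxy : z ^+ 2 <= x * y.
  have -> : x * y = (D * b) * (a ^+ k.+1 * S) by rewrite /x /y; field; rewrite gt_eqF.
  rewrite /z exprMn ler_pM ?sqr_ge0//; first by rewrite /D; nra.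
  by rewrite /S; nra.
have xyz : 2 * z <= x + y.
  rewrite (le_trans (ler_norm _))// -(@ler_pXn2r _ 2)// ?nnegrE ?addr_ge0// real_normK ?num_real//.
  by have := sqr_ge0 (x - y); nra.
have E : a ^+ k.+2 + b ^+ k.+2 - 2 * c ^+ k.+2 = D * a ^+ k.+1 + b * S + 2 * z.
  by rewrite [a ^+ k.+2]exprS [b ^+ k.+2]exprS [c ^+ k.+2]exprS /D /S /z; ring.
have aN' : a ^+ k.+1 <= N ^+ k.+1 by rewrite lerXn2r// nnegrE.
have h1 : D * a ^+ k.+1 + x <= (1 + k.+1%:R) * (D * N ^+ k.+1).
  rewrite /x; have : D * a ^+ k.+1 <= D * N ^+ k.+1 by rewrite ler_wpM2l.
  move: (D * a ^+ k.+1) (D * N ^+ k.+1) (mulrA k.+1%:R D (a ^+ k.+1)) => p q <- pq.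
  by rewrite -[X in X + _]mul1r -mulrDl ler_wpM2l// addr_ge0// ltW.
have h2 : b * S + y <= (1 + k.+1%:R^-1) * (k.+1%:R ^+ 2 * (D * N ^+ k.+1)).
  have -> : b * S + y = (1 + k.+1%:R^-1) * (b * S) by rewrite /y; ring.
  rewrite ler_wpM2l ?addr_ge0 ?invr_ge0 ?(ltW k0)//.
  have -> : k.+1%:R ^+ 2 * (D * N ^+ k.+1) = N * (k.+1%:R ^+ 2 * N ^+ k * D).
    by rewrite [N ^+ k.+1]exprS; ring.
  by rewrite ler_pM.
have -> : k.+2%:R ^+ 2 * N ^+ k.+1 * D =
  (1 + k.+1%:R) * (D * N ^+ k.+1) + (1 + k.+1%:R^-1) * (k.+1%:R ^+ 2 * (D * N ^+ k.+1)).
  by rewrite -[k.+2%:R]natr1; field; rewrite gt_eqF.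
by rewrite E (le_trans _ (lerD h1 h2))// addrACA lerD2l.
Qed.

End power_inequalities.

(** * Finite nets on the spheres *)

Section sphere_nets.
Context {R : realType} {n : nat}.
Implicit Types (u v : 'rV[R]_n).

Definition lq_sphere (q : nat) : set 'rV[R]_n := [set u | \sum_i `|u 0 i| ^+ q = 1].

Lemma lq_sphere_coord_le1 q u i : (0 < q)%N -> lq_sphere q u -> `|u 0 i| <= 1.
Proof.
move=> q0 us; rewrite -(@expr_le1 _ q)// -us (bigD1 i)//= lerDl.
by apply: sumr_ge0 => j _; rewrite exprn_ge0.
Qed.

Lemma lq_sphere_nonempty q : (0 < q)%N -> (0 < n)%N -> exists u, lq_sphere q u.
Proof.
move=> q0 n0; exists (\row_i (i == Ordinal n0)%:R); rewrite /lq_sphere/=.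
rewrite (bigD1 (Ordinal n0))//= big1 ?addr0 => [|i /negPf ni].
  by rewrite mxE eqxx normr1 expr1n.
by rewrite mxE ni normr0 expr0n gtn_eqF.
Qed.

(** The cube [[-1, 1]^n] is cut into cells of side [1/(N+1)], and one sphere point is chosen in each
    cell that meets the sphere. The net thus lies on the sphere, where the increment bounds hold. *)
Lemma lq_sphere_net q N : (0 < q)%N -> (0 < n)%N ->
  exists M, (0 < M)%N /\ exists u : 'I_M -> 'rV[R]_n, (forall l, lq_sphere q (u l)) /\
    forall v, lq_sphere q v -> exists l, forall i, `|v 0 i - u l 0 i| <= N.+1%:R^-1.
Proof.
move=> q0 n0; have [u0 u0S] := lq_sphere_nonempty q0 n0.
(* The truncation of [(u_i + 1) (N+1)] takes values from [0] to [2 (N+1)] included, hence the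
   ordinals ['I_K.+1]. Cells that miss the sphere get the default [u0]. *)
pose K := (2 * N.+1)%N.
pose trunc u i := Num.truncn ((u 0 i + 1) * N.+1%:R).
pose cell u : {ffun 'I_n -> 'I_K.+1} := [ffun i => inord (trunc u i)].
have N0 : 0 < N.+1%:R :> R by rewrite ltr0n.
have uge0 u i : lq_sphere q u -> 0 <= (u 0 i + 1) * N.+1%:R.
  move=> uS; rewrite mulr_ge0//.
  by have := lq_sphere_coord_le1 i q0 uS; rewrite ler_norml; lra.
have truncK u i : lq_sphere q u -> (trunc u i < K.+1)%N.
  move=> uS; rewrite ltnS -(ler_nat R) /trunc.
  have /andP[+ _] := truncn_itv (uge0 u i uS); move=> /le_trans; apply.
  rewrite /K natrM ler_wpM2r//.
  by have := lq_sphere_coord_le1 i q0 uS; rewrite ler_norml; lra.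
have close u v : lq_sphere q u -> lq_sphere q v -> cell u = cell v ->
    forall i, `|u 0 i - v 0 i| <= N.+1%:R^-1.
  move=> uS vS uv i; have /(congr1 (@nat_of_ord _)) := congr1 (fun f : {ffun _ -> _} => f i) uv.
  rewrite !ffunE !inordK ?truncK// => tuv.
  have /andP[ul uu] := truncn_itv (uge0 u i uS).
  have /andP[vl vu] := truncn_itv (uge0 v i vS).
  rewrite -/(trunc u i) in ul uu; rewrite -/(trunc v i) -tuv in vl vu.
  rewrite -natr1 in uu; rewrite -natr1 in vu.
  rewrite -(@ler_pM2r _ N.+1%:R)// mulVf ?gt_eqF// -{1}(gtr0_norm N0) -normrM mulrBl.
  by rewrite ler_norml; apply/andP; split; lra.
pose rep (c : {ffun 'I_n -> 'I_K.+1}) := xget u0 [set u | lq_sphere q u /\ cell u = c].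
have repS c : lq_sphere q (rep c).
  by rewrite /rep; case: xgetP => [x _ []|].
exists #|{: {ffun 'I_n -> 'I_K.+1}}|; split.
  by apply/card_gt0P; exists (cell u0).
exists (fun l => rep (enum_val l)); split=> [l|v vS]; first exact: repS.
exists (enum_rank (cell v)) => i; rewrite enum_rankK; apply: close => //.
have : [set u | lq_sphere q u /\ cell u = cell v] (rep (cell v)).
  by apply: xgetPex; exists v.
by case=> _ ->.
Qed.

(** Telescoping: one factor is exchanged at a time, the others being at most 1 in absolute value. *)
Lemma prod_dist_le (I : Type) (s : seq I) (x y : I -> R) :
  (forall i, `|x i| <= 1) -> (forall i, `|y i| <= 1) ->
  `|\prod_(i <- s) x i - \prod_(i <- s) y i| <= \sum_(i <- s) `|x i - y i|.
Proof.
move=> x1 y1; elim: s => [|i s IH]; first by rewrite !big_nil subrr normr0.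
rewrite !big_cons; set X := \prod_(j <- s) x j in IH *; set Y := \prod_(j <- s) y j in IH *.
have Y1 : `|Y| <= 1.
  rewrite /Y; elim: (s) => [|j r IHr]; first by rewrite big_nil normr1.
  by rewrite big_cons normrM mulr_ile1.
have -> : x i * X - y i * Y = (x i - y i) * Y + x i * (X - Y) by ring.
rewrite (le_trans (ler_normD _ _))// lerD// normrM.
  by rewrite ler_piMr.
by rewrite (le_trans _ IH)// ler_piMl.
Qed.

Lemma tensor_form_lip d (A : tensor R n d) (e : R) u v :
  (forall i, `|u 0 i| <= 1) -> (forall i, `|v 0 i| <= 1) ->
  (forall i, `|u 0 i - v 0 i| <= e) ->
  tensor_form A u <= tensor_form A v + (\sum_t `|A t|) * (d%:R * e).
Proof.
move=> u1 v1 uv; rewrite -lerBlDl /tensor_form -sumrB mulr_suml; apply: ler_sum => t _.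
rewrite -mulrBr (le_trans (ler_norm _))// normrM ler_wpM2l//.
rewrite (le_trans (prod_dist_le _ _ _))//.
rewrite (@le_trans _ _ (\sum_(k < d) e))//; first exact: ler_sum.
by rewrite sumr_const card_ord mulr_natl.
Qed.

Lemma tensor_form_dist d (A B : tensor R n d) u : (forall i, `|u 0 i| <= 1) ->
  tensor_form A u <= tensor_form B u + \sum_t `|A t - B t|.
Proof.
move=> u1; rewrite -lerBlDl /tensor_form -sumrB; apply: ler_sum => t _.
rewrite -mulrBl (le_trans (ler_norm _))// normrM ler_piMr//.
by rewrite normr_prod prodr_ile1// => k _; rewrite normr_ge0 u1.
Qed.

End sphere_nets.

(** * From the net to the expected maximum *)

Section supremum_expectation.
Context {R : realType} d (T : measurableType d) (P : probability T R) {n k : nat}.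
Hypotheses (n0 : (0 < n)%N) (k0 : (0 < k)%N).
Variables (A : k.-tuple 'I_n -> {RV P >-> R}).
Hypothesis hA : symmetric_gaussian_tensor A.
Local Notation tup := (k.-tuple 'I_n).
Local Notation card t := (#|index_perms (t : tup)|%:R : R).

Lemma sorted_representative (t : tup) : exists2 s, s \in sorted_index n k & perm_eq s t.
Proof.
pose le_ord : rel 'I_n := fun i j => (i <= j)%N.
exists [tuple of sort le_ord t]; last by rewrite perm_sort.
by rewrite inE sorted_map sort_sorted// => i j; exact: leq_total.
Qed.

Lemma card_index_perms_gt0 (t : tup) : 0 < card t.
Proof.
rewrite ltr0n; apply/card_gt0P; exists t.
by rewrite inE perm_refl.
Qed.

Lemma entry_integrable (t : tup) : P.-integrable setT (fun w => (A t w)%:E).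
Proof.
have [s sS st] := sorted_representative t.
have := gaussian_rv_integrable _ (sgt_gaussian hA sS).
under eq_fun do rewrite (sgt_symmetric hA _ st).
apply; rewrite divr_gt0 ?card_index_perms_gt0//.
by rewrite ltr0n.
Qed.

Variables (q : nat) (rho : tensor R n k -> R).
Hypothesis q2 : (2 <= q)%N.
Hypothesis rho_max : forall B : tensor R n k, exists u : 'rV[R]_n,
  [/\ lq_sphere q u, rho B = tensor_form B u &
      forall v, lq_sphere q v -> tensor_form B v <= tensor_form B u].

Let q0 : (0 < q)%N. Proof. exact: ltnW. Qed.

(** Seen as a function of the vector of all entries, [rho] is Lipschitz: the maximiser for one
    tensor is a competitor for the other. *)
Lemma rho_integrable : P.-integrable setT (fun w => (rho (fun t => A t w))%:E).
Proof.
pose F (z : 'rV[R]_#|{: tup}|) := rho (fun t => z 0 (enum_rank t)).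
have FB z z' : F z <= F z' + #|{: tup}|%:R * `|z - z'|.
  rewrite /F; have [u [uS -> _]] := rho_max (fun t => z 0 (enum_rank t)).
  have [v [vS -> vm]] := rho_max (fun t => z' 0 (enum_rank t)).
  have u1 i := lq_sphere_coord_le1 i q0 uS.
  rewrite (le_trans (@tensor_form_dist _ _ _ _ (fun t => z' 0 (enum_rank t)) _ u1))//.
  apply: lerD; first exact: vm.
  rewrite (@le_trans _ _ (\sum_(t : tup) `|z - z'|))//; last first.
    by rewrite sumr_const mulr_natl.
  apply: ler_sum => t _.
  by have := norm_coord_le (z - z') (enum_rank t); rewrite !mxE.
have lF : lip F.
  exists #|{: tup}|%:R => // z z'; rewrite ler_distl lerBlDr FB/=.
  by rewrite distrC FB.
rewrite (_ : (fun w => _) = (fun w => (F (\row_l A (enum_val l) w))%:E)); last first.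
  apply/funext => w; congr (rho _)%:E; apply/funext => t.
  by rewrite mxE enum_rankK.
apply: (lip_integrable (probT_lty P) lF) => i.
by under eq_fun do rewrite mxE; exact: entry_integrable.
Qed.

Lemma tensor_form_sorted w (u : 'rV[R]_n) :
  tensor_form (fun t => A t w) u =
  \sum_(t in sorted_index n k) A t w * (card t * monom (fun i => u 0 i) t).
Proof.
rewrite /tensor_form (sum_sorted_index (f := fun t => A t w * monom (fun i => u 0 i) t)).
  by apply: eq_bigr => t _; rewrite mulrCA.
by move=> s t st; rewrite (sgt_symmetric hA w st) (monom_perm _ st).
Qed.

(** Covers both eigenvalues: [rho] is any maximum over an [l^q] sphere, and only the increment
    constant [L] depends on the case. *)
Lemma rho_expectation_le (p L lam : R) : p = q%:R / (q%:R - 1) -> 0 <= L -> 0 < lam ->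
  (forall u v : 'rV[R]_n, lq_sphere q u -> lq_sphere q v ->
     k%:R * \sum_(t : tup) (monom (fun i => u 0 i) t - monom (fun i => v 0 i) t) ^+ 2 <=
     L ^+ 2 * \sum_i (u 0 i - v 0 i) ^+ 2) ->
  ('E_P[fun w => rho (fun t => A t w)] <=
   (L * (lam `^ p / p * (n%:R * gauss_moment p) + (q%:R * lam ^+ q)^-1))%:E)%E.
Proof.
move=> pE L0 lam0 hL; set B := L * _.
have irho := rho_integrable.
have rhoE : ('E_P[fun w => rho (fun t => A t w)])%E = (\int[P]_w rho (fun t => A t w))%:E.
  by rewrite unlock /Rintegral fineK//; exact: integrable_fin_num.
rewrite rhoE lee_fin.
have iabs t : P.-integrable setT (fun w => `|A t w|%:E).
  exact: (integrable_abse (entry_integrable t)).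
have iC : P.-integrable setT (fun w => (\sum_(t : tup) `|A t w|)%:E).
  by under eq_fun do rewrite -sumEFin; apply: integrable_sum.
pose C := \int[P]_w (\sum_(t : tup) `|A t w|).
have C0 : 0 <= C by apply: Rintegral_ge0 => w _; exact: sumr_ge0.
have key N : exists2 m : R, 0 <= m & forall be : R, 0 < be ->
    \int[P]_w rho (fun t => A t w) <= B + be^-1 * m + k%:R * N.+1%:R^-1 * C.
  have [M [M0 [u [uS unet]]]] := @lq_sphere_net R n q N q0 n0.
  exists (ln M%:R); first by rewrite ln_ge0// ler1n.
  move=> be be0.
  pose a t : 'rV[R]_M := \row_l (card t * monom (fun i => u l 0 i) t).
  pose Z w := \sum_(t in sorted_index n k) A t w *: (be *: a t).
  have ZE w l : Z w 0 l = be * tensor_form (fun t => A t w) (u l).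
    rewrite tensor_form_sorted summxE mulr_sumr; apply: eq_bigr => t _.
    by rewrite !mxE mulrCA.
  have llse : lip (@lse R M) by exact: lip_lse.
  have iZ l : P.-integrable setT (fun w => (Z w 0 l)%:E).
    under eq_fun do rewrite ZE tensor_form_sorted mulr_sumr -sumEFin.
    apply: integrable_sum => // t _.
    under eq_fun do rewrite mulrCA mulrC EFinM.
    by apply: integrableZl => //; exact: entry_integrable.
  have ilse := lip_integrable (probT_lty P) llse iZ.
  have ElseB : \int[P]_w lse (Z w) <= ln M%:R + be * B.
    have vpos t : t \in sorted_index n k -> 0 < k%:R / card t.
      by move=> _; rewrite divr_gt0 ?card_index_perms_gt0// ltr0n.
    have := @expectation_lse_le _ _ _ P M n _ (sorted_index n k) A (fun t => k%:R / card t)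
      a (fun l i => u l 0 i) q p L be lam M0 q2 L0 be0 lam0 (sgt_independent hA) vpos
      (sgt_gaussian hA) uS _ pE.
    rewrite -mulrA -/B => H.
    have {}H := H _.
    have fE : (\int[P]_w (lse (Z w))%:E)%E = (\int[P]_w lse (Z w))%:E.
      by rewrite /Rintegral fineK//; exact: integrable_fin_num.
    move: H; rewrite -/Z fE lee_fin; apply => l l'.
    apply: le_trans (hL _ _ (uS l) (uS l')).
    (* The variance [k / card t] times the squared weight [(card t)^2] is [k * card t]: the
       normalisation of the entries is what restores the unweighted sum over all tuples. *)
    rewrite (@sum_sorted_index _ _ _ (fun t => (monom (fun i => u l 0 i) t - monom (fun i => u l'
      0 i) t) ^+ 2)); last first.
      by move=> s t st; rewrite !(monom_perm _ st).
    rewrite mulr_sumr; apply: ler_sum => t _; rewrite !mxE -mulrBr exprMn.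
    rewrite le_eqVlt; apply/orP; left; apply/eqP; field.
    by rewrite gt_eqF// card_index_perms_gt0.
  have pointwise w : rho (fun t => A t w) <=
      be^-1 * lse (Z w) + k%:R * N.+1%:R^-1 * (\sum_(t : tup) `|A t w|).
    have [v [vS -> _]] := rho_max (fun t => A t w).
    have [l vl] := unet v vS.
    have := @tensor_form_lip R n k (fun t => A t w) _ v (u l)
      (fun i => lq_sphere_coord_le1 i q0 vS) (fun i => lq_sphere_coord_le1 i q0 (uS l)) vl.
    move=> /le_trans; apply; rewrite [leRHS]addrC [leLHS]addrC mulrC lerD2l.
    rewrite -(ler_pM2l be0) mulrA mulfV ?gt_eqF// mul1r -ZE.
    exact: lse_lb.
  have i1 : P.-integrable setT (fun w => (be^-1 * lse (Z w))%:E).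
    exact: (integrableZl measurableT be^-1 ilse).
  have i2 : P.-integrable setT (fun w => (k%:R * N.+1%:R^-1 * (\sum_(t : tup) `|A t w|))%:E).
    exact: (integrableZl measurableT (k%:R * N.+1%:R^-1) iC).
  have i12 := integrableD measurableT i1 i2.
  rewrite (le_trans (le_Rintegral measurableT irho i12 (fun w _ => pointwise w)))//.
  rewrite RintegralD// RintegralZl// RintegralZl// -/C lerD2r.
  rewrite -(ler_pM2l be0) mulrA mulfV ?gt_eqF// mul1r mulrDr (mulVKf (negbT (gt_eqF be0))).
  by rewrite addrC.
apply/ler_addgt0Pr => e e0.
(* The mesh comes first, making the net error at most [e / 2]. It fixes [m], the logarithm of the
   size of the net, and [be] is then taken large enough for [m / be <= e / 2]. *)
pose N := Num.truncn (2 * k%:R * C / e).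
have [m m0 hm] := key N.
pose be := (m + 1) * 2 / e.
have be0 : 0 < be by rewrite divr_gt0// mulr_gt0// ltr_wpDl.
apply: (le_trans (hm be be0)); rewrite -addrA lerD2l.
have h1 : be^-1 * m <= e / 2.
  rewrite mulrC ler_pdivrMr// /be.
  have -> : e / 2 * ((m + 1) * 2 / e) = m + 1 by field; rewrite gt_eqF.
  by rewrite lerDl.
have h2 : k%:R * N.+1%:R^-1 * C <= e / 2.
  have N0 : 0 < N.+1%:R :> R by rewrite ltr0n.
  rewrite mulrAC ler_pdivrMr//.
  have : 2 * k%:R * C / e < N.+1%:R by exact: truncnS_gt.
  by rewrite ltr_pdivrMr//; lra.
by rewrite [leRHS](splitr e) lerD.
Qed.

End supremum_expectation.

(** * The Gamma function and the constants *)

Section gamma_moment.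
Context {R : realType}.
Local Notation mu := (@lebesgue_measure R).
Local Notation gauss := (normal_prob (0 : R) (1 : R)).

Lemma continuous_powR_gt0 (a x : R) : 0 < x -> {for x, continuous (powR (R:=R) ^~ a)}.
Proof.
move=> x0; apply: differentiable_continuous; apply/derivable1_diffP.
by case: (is_derive1_powR a x0).
Qed.

Lemma continuous_norm_powR (p : R) : 1 <= p -> continuous (fun y : R => `|y| `^ p).
Proof.
move=> p1 x; have [->|x0] := eqVneq x 0; last first.
  apply: (@continuous_comp _ _ _ (fun y : R => `|y|) (fun z => z `^ p));
    first exact: norm_continuous.
  by apply: continuous_powR_gt0; rewrite normr_gt0.
apply/cvgrPdist_lt => e e0; rewrite normr0 powR0 ?gt_eqF ?(lt_le_trans ltr01)//.
near=> t; rewrite sub0r normrN ger0_norm ?powR_ge0//.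
have t1 : `|0 - t| <= 1.
  by near: t; apply: (@cvgr_dist_le _ _ _ _ _ id (0 : R)).
have te : `|0 - t| < e.
  by near: t; apply: (@cvgr_dist_lt _ _ _ _ _ id (0 : R)).
rewrite sub0r normrN in t1 te.
apply: le_lt_trans te; have [->|tn0] := eqVneq t 0.
  by rewrite normr0 powR0// gt_eqF// (lt_le_trans ltr01).
rewrite -[leRHS]powRr1// ger_powR//; last by rewrite normr_gt0 tn0.
Unshelve. all: by end_near. Qed.

Lemma bigcup_itv_invS : \bigcup_(k in [set: nat]) `[(k.+1%:R)^-1, k.+1%:R]%classic = `]0,
  +oo[%classic :> set R.
Proof.
apply/seteqP; split => x /=.
  move=> [k _] /=; rewrite !in_itv/= andbT => /andP[kx _].
  by rewrite (lt_le_trans _ kx)// invr_gt0.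
rewrite in_itv/= andbT => x0.
pose k := maxn (Num.truncn x) (Num.truncn x^-1); exists k => //=; rewrite in_itv/=.
apply/andP; split.
  rewrite -[leRHS]invrK lef_pV2 ?posrE ?invr_gt0// ltW// (lt_le_trans (truncnS_gt _))//.
  by rewrite ler_nat ltnS leq_maxr.
rewrite ltW// (lt_le_trans (truncnS_gt _))//.
by rewrite ler_nat ltnS leq_maxl.
Qed.

(* The half-line substitution rules of the library ask the derivative of the
   substitution to converge at +oo, hence the detour by compact intervals. *)
Lemma ge0_integral_half_square (G : R -> R) : (forall t, 0 < t -> {for t, continuous G}) ->
  (forall t, 0 < t -> 0 <= G t) ->
  (\int[mu]_(t in `]0%R, +oo[) (G t)%:E =
   \int[mu]_(y in `]0%R, +oo[) (G (y ^+ 2 / 2) * y)%:E)%E.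
Proof.
move=> cG G0; pose F (y : R) := y ^+ 2 / 2.
have F' : F^`()%classic = id.
  apply/funext => y; rewrite derive1E /F.
  have h : is_derive y 1 (fun y : R => y ^+ 2 / 2) y.
    apply: is_derive_eq; rewrite /GRing.scale/= ?mulr1 ?mulr0 ?add0r; by field.
  by rewrite (@derive_val _ _ _ _ _ _ _ h).
pose a k : R := (k.+1%:R)^-1; pose b k : R := k.+1%:R.
have a0 k : 0 < a k by rewrite invr_gt0.
have b0 k : 0 < b k by rewrite ltr0n.
have ab k : a k <= b k by rewrite (@le_trans _ _ 1)// ?invf_le1// ?ler1n.
have ahomo k l : (k <= l)%N -> a l <= a k by move=> kl; rewrite lef_pV2 ?posrE// ler_nat.
have bhomo k l : (k <= l)%N -> b k <= b l by move=> kl; rewrite ler_nat.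
have cF : continuous F.
  move=> y; apply: cvgM; [exact: exprn_continuous|exact: cvg_cst].
have subs k : (\int[mu]_(t in `[F (a k), F (b k)]) (G t)%:E =
    \int[mu]_(y in `[a k, b k]) (G (y ^+ 2 / 2) * y)%:E)%E.
  rewrite integration_by_substitution_increasing//.
  - by apply: eq_integral => y _; rewrite F'.
  - move=> x y; rewrite !in_itv/= => /andP[ax _] /andP[ay _] xy.
    rewrite /F ltr_pM2r// ltrXn2r// ?(le_trans (ltW (a0 k)))//.
  - by rewrite F' => x _; exact: cvg_id.
  - by rewrite F'; apply/cvg_ex; exists (a k); exact: cvg_at_right_filter.
  - by rewrite F'; apply/cvg_ex; exists (b k); exact: cvg_at_left_filter.
  - split.
    + by move=> x _; rewrite /F.
    + exact/cvg_at_right_filter/cF.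
    + exact/cvg_at_left_filter/cF.
  - apply: continuous_in_subspaceT => x; rewrite inE/= in_itv/= => /andP[Fx _].
    by apply: cG; rewrite (lt_le_trans _ Fx)// /F divr_gt0// exprn_gt0.
have cvgG : (\int[mu]_(t in `[F (a k), F (b k)]) (G t)%:E)%E @[k --> \oo] -->
    (\int[mu]_(t in \bigcup_k `[F (a k), F (b k)]%classic) (G t)%:E)%E.
  apply: ge0_nondecreasing_set_cvg_integral => //.
  - move=> k l kl; apply/subsetPset => x /=; rewrite !in_itv/= => /andP[ax xb].
    apply/andP; split.
      by rewrite (le_trans _ ax)// /F ler_pM2r// lerXn2r ?nnegrE ?ahomo// ltW.
    by rewrite (le_trans xb)// /F ler_pM2r// lerXn2r ?nnegrE ?bhomo// ltW.
  - move=> k; apply/measurable_EFinP; apply: subspace_continuous_measurable_fun => //.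
    apply: continuous_in_subspaceT => x; rewrite inE/= in_itv/= => /andP[Fx _].
    by apply: cG; rewrite (lt_le_trans _ Fx)// /F divr_gt0// exprn_gt0.
  - move=> k x /=; rewrite in_itv/= => /andP[Fx _]; rewrite lee_fin G0//.
    by rewrite (lt_le_trans _ Fx)// /F divr_gt0// exprn_gt0.
have cvgF : (\int[mu]_(y in `[a k, b k]) (G (y ^+ 2 / 2) * y)%:E)%E @[k --> \oo] -->
    (\int[mu]_(y in \bigcup_k `[a k, b k]%classic) (G (y ^+ 2 / 2) * y)%:E)%E.
  apply: ge0_nondecreasing_set_cvg_integral => //.
  - move=> k l kl; apply/subsetPset => x /=; rewrite !in_itv/= => /andP[ax xb].
    by rewrite (le_trans (ahomo _ _ kl) ax) (le_trans xb (bhomo _ _ kl)).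
  - move=> k; apply/measurable_EFinP; apply: subspace_continuous_measurable_fun => //.
    apply: continuous_in_subspaceT => x; rewrite inE/= in_itv/= => /andP[ax _].
    have x0 : 0 < x by rewrite (lt_le_trans _ ax).
    apply: cvgM; last exact: cvg_id.
    apply: (@continuous_comp _ _ _ F G); first exact: cF.
    by apply: cG; rewrite /F divr_gt0// exprn_gt0.
  - move=> k x /=; rewrite in_itv/= => /andP[ax _].
    have x0 : 0 < x by rewrite (lt_le_trans _ ax).
    by rewrite lee_fin mulr_ge0 ?(ltW x0)// G0// divr_gt0// exprn_gt0.
have U1 : \bigcup_k `[a k, b k]%classic = `]0, +oo[%classic :> set R by exact: bigcup_itv_invS.
have U2 : \bigcup_k `[F (a k), F (b k)]%classic = `]0, +oo[%classic :> set R.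
  apply/seteqP; split => x /=.
    move=> [k _] /=; rewrite !in_itv/= andbT => /andP[kx _].
    by rewrite (lt_le_trans _ kx)// divr_gt0// exprn_gt0.
  rewrite in_itv/= andbT => x0.
  have s0 : 0 < Num.sqrt (2 * x) by rewrite sqrtr_gt0 mulr_gt0.
  have : (\bigcup_k `[a k, b k]%classic) (Num.sqrt (2 * x)).
    by rewrite U1 /= in_itv/= s0.
  move=> [k _] /=; rewrite in_itv/= => /andP[ak bk]; exists k => //=.
  have xE : x = F (Num.sqrt (2 * x)).
    by rewrite /F sqr_sqrtr ?mulr_ge0 ?(ltW x0)// mulrC mulKf.
  rewrite in_itv/= xE /F !ler_pM2r// !lerXn2r ?nnegrE ?(ltW s0) ?(ltW (a0 k)) ?(ltW (b0 k))//.
rewrite -[in LHS]U2 -[in RHS]U1.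
rewrite (_ : (fun k => _) = (fun k => \int[mu]_(y in `[a k, b k]) (G (y ^+ 2 / 2) * y)%:E)%E) in
  cvgG;
  last by apply/funext => k; exact: subs.
exact: (cvg_unique _ cvgG cvgF).
Qed.

(** By evenness only the half-line counts, and there [t = y^2 / 2] turns the moment into the Gamma
    integral. *)
Lemma gauss_momentE (p : R) : 1 < p -> p <= 2 ->
  gauss_moment p = 2 `^ (p / 2) * (pi `^ (- (1 / 2)) * Gamma ((p + 1) / 2)).
Proof.
move=> p1 p2; set c := 2 `^ (p / 2) * pi `^ (- (1 / 2)).
have p0 : 0 < p by lra.
have c0 : 0 <= c by rewrite mulr_ge0 ?powR_ge0.
pose x := (p + 1) / 2.
pose G (t : R) := t `^ (x - 1) * expR (- t).
have mpowR : measurable_fun [set: R] (fun y : R => (`|y| `^ p)%:E).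
  by apply/measurable_EFinP; exact: continuous_measurable_fun (continuous_norm_powR (ltW p1)).
pose h (y : R) := `|y| `^ p * normal_pdf 0 1 y.
have h0 y : 0 <= h y by rewrite mulr_ge0 ?powR_ge0 ?normal_pdf_ge0.
have ch : continuous h.
  move=> y; apply: cvgM; first exact: (continuous_norm_powR (ltW p1)).
  by apply: continuous_normal_pdf; rewrite oner_eq0.
have gmE : (\int[gauss]_y (`|y : R| `^ p)%:E = \int[mu]_y (h y)%:E)%E.
  rewrite (ge0_integral_normal_prob 0 1 mpowR); last by move=> y; rewrite lee_fin powR_ge0.
  by apply: eq_integral => y _; rewrite -EFinM.
have hG y : 0 < y -> h y = c / 2 * (G (y ^+ 2 / 2) * y).
  move=> y0; rewrite /h gtr0_norm// normal_pdfE ?oner_eq0//.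
  rewrite /normal_peak /normal_fun /G /x subr0 expr1n mul1r.
  have -> : - y ^+ 2 / (1 *+ 2) = - (y ^+ 2 / 2) :> R by rewrite mulNr.
  have -> : (p + 1) / 2 - 1 = (p - 1) / 2 by field.
  rewrite powRM ?sqr_ge0 ?invr_ge0//.
  have -> : (y ^+ 2) `^ ((p - 1) / 2) = y `^ (p - 1).
    by rewrite -powR_mulrn ?(ltW y0)// -powRrM; congr (_ `^ _); field.
  have -> : y `^ p = y `^ (p - 1) * y by rewrite mulrC mulr_powRB1// ltW.
  have -> : (Num.sqrt (pi *+ 2))^-1 = c / 2 * 2^-1 `^ ((p - 1) / 2) :> R.
    have -> : 2^-1 `^ ((p - 1) / 2) = 2 `^ (- ((p - 1) / 2)) :> R.
      by rewrite -(@powR_inv1 _ 2)// -powRrM mulN1r.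
    have -> : (Num.sqrt (pi *+ 2))^-1 = 2 `^ (- 2^-1) * pi `^ (- 2^-1) :> R.
      by rewrite -[pi *+ 2]mulr_natl sqrtrM// invfM -!powR12_sqrt ?pi_ge0// !powRN.
    have -> : 2 `^ (- 2^-1) = 2 `^ (p / 2) / 2 * 2 `^ (- ((p - 1) / 2)) :> R.
      rewrite -[X in _ / X](@powRr1 _ 2)// -powRN -!powRD ?pnatr_eq0 ?implybT//.
      by congr (_ `^ _); field.
    by rewrite /c div1r mulrAC; congr (_ * _); rewrite mulrAC.
  move: (y `^ (p - 1)) (c / 2) (2^-1 `^ _) (expR _) => a1 a2 a3 a4.
  by ring.
have halfE : (\int[mu]_(y in [set y | (0 <= y)%R]) (h y)%:E =
    (c / 2)%:E * \int[mu]_(t in `]0%R, +oo[) (G t)%:E)%E.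
  rewrite -set_itvcy -integral_itv_obnd_cbnd; last first.
    by apply/measurable_EFinP/measurable_funTS; exact: continuous_measurable_fun.
  rewrite (@ge0_integral_half_square G); last 2 first.
  - move=> t t0; apply: cvgM; first exact: continuous_powR_gt0.
    apply: (@continuous_comp _ _ _ (fun t : R => - t) expR);
      [exact: continuousN|exact: continuous_expR].
  - by move=> t t0; rewrite mulr_ge0 ?powR_ge0 ?expR_ge0.
  rewrite -ge0_integralZl//=.
  - by apply: eq_integral => y; rewrite inE/= in_itv/= andbT => y0; rewrite -EFinM hG.
  - apply/measurable_EFinP/measurable_funTS; apply: measurable_funM => //.
    have msq : measurable_fun [set: R] (fun y : R => y ^+ 2 / 2).
      by apply: measurable_funM => //; exact: measurable_funX.
    apply: measurable_funM; first exact: (measurableT_comp (measurable_powR (x - 1)) msq).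
    by apply: measurableT_comp => //; apply: measurableT_comp.
  - by move=> y; rewrite in_itv/= andbT => y0; rewrite lee_fin mulr_ge0 ?(ltW y0)// mulr_ge0
    ?powR_ge0 ?expR_ge0.
  - by rewrite lee_fin divr_ge0.
have heven : h =1 h \o -%R.
  by move=> y /=; rewrite /h normrN !normal_pdfE ?oner_eq0// /normal_fun !subr0 sqrrN.
have cp : 0 < c by rewrite mulr_gt0 ?powR_gt0// pi_gt0.
rewrite /gauss_moment {1}/Rintegral gmE ge0_symfun_integralT// halfE muleA -EFinM mulrC divfK//.
rewrite mulrA -/c /Gamma /Rintegral -/x -/G.
(* Should the integral be infinite, [fine] returns 0 on both sides. *)
case: (\int[mu]_(t in _) _)%E => [r| |] //=.
  by rewrite gt0_muley ?lte_fin//= mulr0.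
by rewrite gt0_muleNy ?lte_fin//= mulr0.
Qed.

End gamma_moment.

(** * Optimisation and identification of the constants *)

Section final_constants.
Context {R : realType}.

Lemma young_optimum (q : nat) (p S : R) : (2 <= q)%N -> p = q%:R / (q%:R - 1) -> 0 < S ->
  exists2 lam : R, 0 < lam & lam `^ p / p * S + (q%:R * lam ^+ q)^-1 = S `^ p^-1.
Proof.
move=> q2 pE S0.
have q2R : 2 <= q%:R :> R by rewrite (ler_nat _ 2).
have q1 : 0 < q%:R - 1 :> R by lra.
have q0 : 0 < q%:R :> R by lra.
have p0 : 0 < p by rewrite pE divr_gt0.
have pq : p^-1 = 1 - q%:R^-1 by rewrite pE; field; rewrite !gt_eqF.
(* The stationary point: [lam^(p+q) = 1/S], with [p + q = p q] for conjugate exponents. The two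
   terms become [S^(1/p) / p] and [S^(1/p) / q]. *)
exists (S `^ (- (p * q%:R)^-1)); first exact: powR_gt0.
rewrite -powR_mulrn ?powR_ge0// -!powRrM [(q%:R * _)^-1]invfM -powRN.
have -> : - (- (p * q%:R)^-1 * q%:R) = p^-1 by field; rewrite !gt_eqF.
have -> : - (p * q%:R)^-1 * p = - q%:R^-1 by field; rewrite !gt_eqF.
have -> : S `^ (- q%:R^-1) / p * S = S `^ p^-1 / p.
  rewrite mulrAC -[X in _ * X / _](@powRr1 _ S) ?(ltW S0)// -powRD;
    last by rewrite (gt_eqF S0) implybT.
  by rewrite pq addrC.
by rewrite mulrC -mulrDl pq subrK mul1r.
Qed.

(** Lagrange's identity: twice the difference of the two sides is the sum of the squares
    [(x i * y j - x j * y i) ^+ 2]. *)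
Lemma cauchy_schwarz_sum (n : nat) (x y : 'I_n -> R) :
  (\sum_i x i * y i) ^+ 2 <= (\sum_i x i ^+ 2) * (\sum_i y i ^+ 2).
Proof.
have e1 : (\sum_i x i ^+ 2) * (\sum_i y i ^+ 2) = \sum_i \sum_j x i ^+ 2 * y j ^+ 2.
  by rewrite mulr_suml; apply: eq_bigr => i _; rewrite mulr_sumr.
have e2 : (\sum_i x i ^+ 2) * (\sum_i y i ^+ 2) = \sum_i \sum_j x j ^+ 2 * y i ^+ 2.
  by rewrite e1 exchange_big.
have e3 : (\sum_i x i * y i) ^+ 2 = \sum_i \sum_j (x i * y i) * (x j * y j).
  by rewrite expr2 mulr_suml; apply: eq_bigr => i _; rewrite mulr_sumr.
have : 0 <= \sum_i \sum_j (x i * y j - x j * y i) ^+ 2.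
  by apply: sumr_ge0 => i _; apply: sumr_ge0 => j _; exact: sqr_ge0.
have -> : \sum_i \sum_j (x i * y j - x j * y i) ^+ 2 =
    \sum_i \sum_j x i ^+ 2 * y j ^+ 2 + \sum_i \sum_j x j ^+ 2 * y i ^+ 2 -
    (\sum_i \sum_j (x i * y i) * (x j * y j) + \sum_i \sum_j (x i * y i) * (x j * y j)).
  rewrite -!big_split -sumrB/=; apply: eq_bigr => i _.
  by rewrite -!big_split -sumrB/=; apply: eq_bigr => j _; ring.
rewrite -e1 -e2 -e3; lra.
Qed.

Lemma sum_sqr_dist (n : nat) (x y : 'I_n -> R) :
  \sum_i (x i - y i) ^+ 2 = \sum_i x i ^+ 2 + \sum_i y i ^+ 2 - 2 * \sum_i x i * y i.
Proof. by rewrite mulr_sumr -big_split -sumrB/=; apply: eq_bigr => i _; ring. Qed.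

(* Young's inequality against a constant vector. *)
Lemma lq_sphere_sqr_le (n d : nat) (u : 'rV[R]_n) : (2 <= d)%N -> (0 < n)%N ->
  lq_sphere d u -> \sum_i u 0 i ^+ 2 <= n%:R `^ ((d%:R - 2) / d%:R).
Proof.
move=> d2 n0 uS; have nR : 0 < n%:R :> R by rewrite ltr0n.
have sqE i : u 0 i ^+ 2 = `|u 0 i| ^+ 2 by rewrite real_normK ?num_real.
(* For [d = 2] the exponent [d / (d - 2)] used below degenerates, and the claim is the sphere
   equation. *)
move: d2; rewrite leq_eqVlt => /predU1P[d2|d3].
  rewrite -d2 subrr mul0r powRr0; under eq_bigr do rewrite sqE.
  by move: uS; rewrite /lq_sphere/= -d2 => ->.
have d3R : 3 <= d%:R :> R by rewrite (ler_nat _ 3).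
(* [kap] is chosen so that [kap^(d/(d-2)) = 1/n]; the sum over [i] of the Young bounds is then
   [2/d + a = 1]. *)
set a := (d%:R - 2) / d%:R; pose kap : R := n%:R `^ (- a).
have k0 : 0 < kap by rewrite powR_gt0.
suff : kap * \sum_i u 0 i ^+ 2 <= 1.
  by rewrite mulrC -ler_pdivlMr// div1r /kap powRN invrK.
have young i : kap * u 0 i ^+ 2 <= (2 / d%:R) * `|u 0 i| ^+ d + a * n%:R^-1.
  have p0 : 0 < d%:R / 2 :> R by rewrite divr_gt0//; lra.
  have q0 : 0 < d%:R / (d%:R - 2) :> R by rewrite divr_gt0//; lra.
  have pq : (d%:R / 2)^-1 + (d%:R / (d%:R - 2))^-1 = 1 :> R.
    by field; apply/andP; split; lra.
  have := conjugate_powR (sqr_ge0 (u 0 i)) (ltW k0) p0 q0 pq.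
  rewrite [_ * kap]mulrC sqE -[`|u 0 i| ^+ 2]powR_mulrn// -powRrM /kap -powRrM.
  have -> : 2%:R * (d%:R / 2) = d%:R :> R by field.
  have -> : - a * (d%:R / (d%:R - 2)) = - 1 by rewrite /a; field; apply/andP; split; lra.
  rewrite powR_inv1 ?(ltW nR)// powR_mulrn// !invf_div -/a.
  by rewrite (powR_mulrn d (normr_ge0 _)) [_ * (2 / _)]mulrC [_ * a]mulrC.
rewrite mulr_sumr (le_trans (ler_sum _ (fun i _ => young i)))//.
rewrite big_split/= -mulr_sumr uS sumr_const card_ord -[X in _ + X]mulr_natl mulr1 mulrCA.
rewrite mulfV ?gt_eqF// mulr1 /a le_eqVlt; apply/orP; left; apply/eqP; field; lra.
Qed.

Lemma Gamma_ge0 (x : R) : 0 <= Gamma x.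
Proof.
by apply: Rintegral_ge0 => t _; rewrite mulr_ge0 ?powR_ge0 ?expR_ge0.
Qed.

(** For [p = d/(d-1)] the factor [2^(p/2)] of the moment, raised to [1/p], is the missing [2^(1/2)].
    In this form the last inequality of the theorem says that the moment is at most 1. *)
Lemma h_constantE (d : nat) : (2 <= d)%N ->
  2 `^ (d%:R / 2) * (pi `^ (- (1 / 2)) * Gamma (1 / (2 * (d%:R - 1)) + 1))
    `^ ((d%:R - 1) / d%:R) =
  2 `^ ((d%:R - 1) / 2) * gauss_moment (d%:R / (d%:R - 1)) `^ ((d%:R - 1) / d%:R) :> R.
Proof.
move=> d2; have d2R : 2 <= d%:R :> R by rewrite (ler_nat _ 2).
have d1 : 0 < d%:R - 1 :> R by lra.
rewrite gauss_momentE; last 2 first.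
- by rewrite ltr_pdivlMr//; lra.
- by rewrite ler_pdivrMr//; lra.
have -> : (d%:R / (d%:R - 1) + 1) / 2 = 1 / (2 * (d%:R - 1)) + 1 :> R.
  by field; rewrite gt_eqF.
rewrite [in RHS]powRM ?powR_ge0//; last by rewrite mulr_ge0 ?powR_ge0 ?Gamma_ge0.
rewrite -powRrM mulrA -powRD ?pnatr_eq0 ?implybT//.
by congr (_ `^ _ * _); field; apply/andP; split; lra.
Qed.

End final_constants.

Theorem theorem2p2 (R : realType) (disp : measure_display)
    (T : measurableType disp) (P : probability T R) (d n : nat)
    (hd : (2 <= d)%N) (hn : (1 <= n)%N)
    (A : d.-tuple 'I_n -> {RV P >-> R}) (hA : symmetric_gaussian_tensor A) :
  ('E_P[fun w => rho_z (fun t => A t w)] <= (d%:R * Num.sqrt n%:R)%:E)%E /\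
  ('E_P[fun w => rho_h (fun t => A t w)] <=
     (d%:R * 2 `^ (d%:R / 2) *
      (pi `^ (- (1 / 2)) * Gamma (1 / (2 * (d%:R - 1)) + 1))
        `^ ((d%:R - 1) / d%:R) *
      n%:R `^ ((d%:R - 1) / 2))%:E)%E /\
  d%:R * 2 `^ (d%:R / 2) *
    (pi `^ (- (1 / 2)) * Gamma (1 / (2 * (d%:R - 1)) + 1))
      `^ ((d%:R - 1) / d%:R) *
    n%:R `^ ((d%:R - 1) / 2) <=
  d%:R * 2 `^ ((d%:R - 1) / 2) * n%:R `^ ((d%:R - 1) / 2) :> R.
Proof.
have d0 : (0 < d)%N by exact: ltnW.
have d2R : 2 <= d%:R :> R by rewrite (ler_nat _ 2).
have d1 : 0 < d%:R - 1 :> R by lra.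
have nR : 0 < n%:R :> R by rewrite ltr0n.
rewrite -![d%:R * 2 `^ (d%:R / 2) * _]mulrA h_constantE// mulrA.
set p := d%:R / (d%:R - 1).
have p0 : 0 < p by rewrite divr_gt0//; lra.
have p2 : p <= 2 by rewrite /p ler_pdivrMr//; lra.
have pV : (d%:R - 1) / d%:R = p^-1 by rewrite /p invf_div.
have m0 := gauss_moment_gt0 p0 p2; have m1 := gauss_moment_le1 p0 p2.
split; [|split].
- have rz (B : tensor R n d) : exists u : 'rV[R]_n,
    [/\ lq_sphere 2 u, rho_z B = tensor_form B u &
      forall v, lq_sphere 2 v -> tensor_form B v <= tensor_form B u].
    have [u [u1 uE um]] := rho_z_max B hn; exists u; split => //.
      by move: u1; rewrite norm2_eq1.
    by move=> v v1; apply: um; rewrite norm2_eq1.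
  have tE : 2 = 2%:R / (2%:R - 1) :> R by field.
  have [lam lam0 lamE] := @young_optimum R 2 2 n%:R (leqnn 2) tE nR.
  have := @rho_expectation_le _ _ _ P n d hn d0 A hA 2 (@rho_z R n d) (leqnn 2) rz 2 d%:R lam
    tE (ler0n _ _) lam0.
  move=> H; apply: le_trans (H _) _.
    move=> u v uS vS.
    have sq (w : 'rV[R]_n) : lq_sphere 2 w -> \sum_i w 0 i ^+ 2 = 1.
      by move=> <-; apply: eq_bigr => i _; rewrite real_normK ?num_real.
    rewrite sum_monom_sqr_dist sum_sqr_dist !sq// expr1n.
    set c := \sum_i _.
    have c1 : `|c| <= 1.
      rewrite -(@ler_pXn2r _ 2)// ?nnegrE// real_normK ?num_real// expr1n.
      by have := cauchy_schwarz_sum (fun i => u 0 i) (fun i => v 0 i); rewrite !sq// mulr1.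
    have := one_subX_le d c1 => h.
    have -> : 1 + 1 - 2 * c ^+ d = 2 * (1 - c ^+ d) by ring.
    have -> : d%:R ^+ 2 * (1 + 1 - 2 * c) = d%:R * (2 * (d%:R * (1 - c))) by ring.
    by rewrite ler_wpM2l// ler_wpM2l.
  rewrite lee_fin ler_wpM2l// -powR12_sqrt ?(ltW nR)// -lamE lerD2r.
  rewrite ler_wpM2l ?divr_ge0 ?powR_ge0// ler_piMr ?(ltW nR)//.
  exact: gauss_moment_le1.
- have rh (B : tensor R n d) : exists u : 'rV[R]_n,
    [/\ lq_sphere d u, rho_h B = tensor_form B u &
      forall v, lq_sphere d v -> tensor_form B v <= tensor_form B u].
    have [u [u1 uE um]] := rho_h_max B d0 hn; exists u; split => //.
      by move: u1; rewrite normd_eq1.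
    by move=> v v1; apply: um; rewrite normd_eq1.
  have nm0 : 0 < n%:R * gauss_moment p by rewrite mulr_gt0.
  have [lam lam0 lamE] := @young_optimum R d p _ hd erefl nm0.
  pose N : R := n%:R `^ ((d%:R - 2) / d%:R).
  (* The last factor is [N^((d-1)/2)]. *)
  pose L : R := d%:R * 2 `^ ((d%:R - 1) / 2) * n%:R `^ ((d%:R - 1) * (d%:R - 2) / (2 * d%:R)).
  have L0 : 0 <= L by rewrite !mulr_ge0 ?powR_ge0.
  have := @rho_expectation_le _ _ _ P n d hn d0 A hA d (@rho_h R n d) hd rh p L lam
    erefl L0 lam0.
  move=> H; apply: le_trans (H _) _.
    move=> u v uS vS.
    have uN := lq_sphere_sqr_le hd hn uS; have vN := lq_sphere_sqr_le hd hn vS.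
    rewrite sum_monom_sqr_dist sum_sqr_dist.
    have D0 : 0 <= \sum_i (u 0 i - v 0 i) ^+ 2 by apply: sumr_ge0 => i _; exact: sqr_ge0.
    rewrite sum_sqr_dist in D0.
    have a0 : 0 <= \sum_i u 0 i ^+ 2 <= N.
      by rewrite uN andbT; apply: sumr_ge0 => i _; exact: sqr_ge0.
    have b0 : 0 <= \sum_i v 0 i ^+ 2 <= N.
      by rewrite vN andbT; apply: sumr_ge0 => i _; exact: sqr_ge0.
    have := powers_dist_le d.-1 a0 b0 (cauchy_schwarz_sum (fun i => u 0 i) (fun i => v 0 i)) D0.
    rewrite prednK// => h.
    rewrite (le_trans (ler_wpM2l (ler0n _ d) h))// mulrA ler_wpM2r//.
    have -> : L ^+ 2 = d%:R ^+ 2 * 2 ^+ d.-1 * N ^+ d.-1.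
      have dp : d.-1%:R = d%:R - 1 :> R by rewrite -subn1 natrB.
      rewrite /L !exprMn; congr (_ * _ * _).
        by rewrite -!powR_mulrn ?powR_ge0// -powRrM dp; congr (_ `^ _); field.
      rewrite -(powR_mulrn 2 (powR_ge0 _ _)) -(powR_mulrn d.-1 (powR_ge0 _ _)) -!powRrM dp.
      congr (_ `^ _).
      by field; lra.
    rewrite mulrA ler_wpM2r ?exprn_ge0 ?powR_ge0// mulrC ler_wpM2l ?exprn_ge0//.
    (* What remains is [d <= 2^(d-1)]. *)
    rewrite -natrX ler_nat.
    by rewrite -[X in (X <= _)%N](prednK d0) ltn_expl.
  rewrite lee_fin lamE powRM ?(ltW nR) ?(ltW m0)// pV /L.
  rewrite le_eqVlt; apply/orP; left; apply/eqP.
  (* The exponents add up: [(d-1)(d-2)/(2d) + (d-1)/d = (d-1)/2]. *)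
  have -> : n%:R `^ ((d%:R - 1) / 2) =
      n%:R `^ ((d%:R - 1) * (d%:R - 2) / (2 * d%:R)) * n%:R `^ p^-1 :> R.
    rewrite -powRD; last by rewrite (gt_eqF nR) implybT.
    rewrite -pV; congr (_ `^ _); field; lra.
  move: (_ `^ _) (n%:R `^ _) (n%:R `^ _) (gauss_moment p `^ _) => x1 x2 x3 x4.
  by ring.
- rewrite ler_wpM2r ?powR_ge0// ler_piMr ?mulr_ge0 ?powR_ge0//.
  have := @ge0_ler_powR _ ((d%:R - 1) / d%:R) _ (gauss_moment p) 1.
  rewrite powR1; apply; rewrite ?nnegrE ?(ltW m0)//.
  by rewrite divr_ge0 ?(ltW d1).
Qed.
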